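(* The tangent vector $(\dot\chi(\omega),\dot\eta(\omega))$ to the frozen boundary curve has slope $$\frac{\dot\chi(\omega)}{\dot\eta(\omega)}=\frac{\omega-\chi(\omega)}{1-\eta(\omega)}=\frac{\Pi(\omega)}{1-\Pi(\omega)}=:\mathcal{T}(\omega).$$ There are sides of $\mathcal{P}$ of three directions to which (or to lines containing which) the curve $\partial\mathcal{D}$ is tangent: (D) The values $\omega=a_i$, $i=1,\dots,k$, correspond to points of $\partial\mathcal{D}$ where it is tangent to sides of $\mathcal{P}$ parallel to the vector $(-1,1)$. Here $\Omega(a_i)=\infty$. (V) When $\omega=b_i$, $i=1,\dots,k$, the frozen boundary $\partial\mathcal{D}$ is tangent to vertical sides of $\mathcal{P}$. We have $\Omega(b_i)=0$. (H) At points $\omega=h_1,\dots,h_k$, where $\Omega(h_i)=1$, the frozen boundary $\partial\mathcal{D}$ is tangent to horizontal sides of $\mathcal{P}$. This includes the case $h_1=-\infty$, where the curve is tangent to the bottom horizontal side of $\mathcal{P}$. One has $h_i\in(b_{i-1},a_i)$, $i=2,\dots,k$. Finally, in each segment $(h_2,h_3),\dots,(h_{k-1},h_k)$ there is one turning point of the frozen boundary.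
   Context: Fix $k\ge2$ and reals $a_1<b_1<\dots<a_k<b_k$ with $\sum_i(b_i-a_i)=1$. The limiting polygon $\mathcal{P}$ in the $(\chi,\eta)$ plane has interior $\{(\chi,\eta):0<\eta<1,\ a_1+1-\eta<\chi<b_k,\ \text{and for no } i:\ a_i+1-\eta\le\chi\le b_i\}$; it has $3k$ sides: $k$ on the lines $\chi=b_i$, $k$ on the lines $\chi+\eta=a_i+1$, the bottom side on $\eta=0$, and $k-1$ top sides $[b_{i-1},a_i]\times\{1\}$. The frozen boundary $\partial\mathcal{D}$ is the boundary of the liquid region (the set of $(\chi,\eta)$ inside $\mathcal{P}$ for which $(w-\chi)\prod_i(w-a_i)=(w-\chi+1-\eta)\prod_i(w-b_i)$ has nonreal solutions $w$). It is parametrized by the real double solution $w=\omega$, $-\infty\le\omega<\infty$: $$\chi(\omega)=\omega+\frac{\Pi(\omega)-1}{\Sigma(\omega)},\quad \eta(\omega)=\frac{\Pi(\omega)(\Sigma(\omega)-\Pi(\omega)+2)-1}{\Pi(\omega)\Sigma(\omega)},\quad \Pi(\omega)=\prod_{i=1}^k\frac{\omega-b_i}{\omega-a_i},\quad \Sigma(\omega)=\sum_{i=1}^k\Big(\frac1{\omega-b_i}-\frac1{\omega-a_i}\Big),$$ with values at $-\infty,a_i,b_i$ understood as limits. Along the curve, $\Omega(\omega)=\frac{\omega-\chi(\omega)}{\omega-\chi(\omega)+1-\eta(\omega)}$. Dots denote derivatives in $\omega$. A turning point is a cusp of the curve, i.e. a point where $w=\omega$ is a triple solution of the equation $(w-\chi)\prod_{i=1}^k(w-a_i)=(w-\chi+1-\eta)\prod_{i=1}^k(w-b_i)$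 in $w$ with $(\chi,\eta)=(\chi(\omega),\eta(\omega))$. *)

(* Defs.v *)
From HB Require Import structures.
From mathcomp Require Import all_boot all_order all_algebra.
From mathcomp Require Import all_classical all_reals all_analysis.

Set Implicit Arguments.
Unset Strict Implicit.
Unset Printing Implicit Defensive.

Import Order.TTheory GRing.Theory Num.Theory.
Import numFieldNormedType.Exports.

Local Open Scope classical_set_scope.
Local Open Scope ring_scope.

(* Indices run over 'I_k, so the paper's a_1 is [a i] with [i = 0 :> nat] and
   its a_k is [a i] with [i.+1 = k]. *)

Section FrozenBoundary.
Context {R : realType} {k : nat}.
Variables a b : 'I_k -> R.
Implicit Types (w x y : R) (i j : 'I_k).

(* At w = a i this has the junk value 0, because 0^-1 = 0. *)
Definition Pi w : R := \prod_(i < k) ((w - b i) / (w - a i)).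

Definition Sigma w : R := \sum_(i < k) ((w - b i)^-1 - (w - a i)^-1).

(* A formula in w, with its values at the points a_i and b_i replaced by
   limits. *)
Definition extend (f : R -> R) w : R :=
  if [exists i, (w == a i) || (w == b i)] then lim (f x @[x --> w^']) else f w.

Definition chi : R -> R := extend (fun w => w + (Pi w - 1) / Sigma w).

Definition eta : R -> R :=
  extend (fun w => (Pi w * (Sigma w - Pi w + 2) - 1) / (Pi w * Sigma w)).

Definition slopeT : R -> R := extend (fun w => Pi w / (1 - Pi w)).

Definition curve w : R * R := (chi w, eta w).

(* The quotient is 0 / 0 where Pi w = 1 and has a zero denominator at w = a i;
   its values are to be read as limits at w. *)
Definition Omega w : R := (w - chi w) / (w - chi w + 1 - eta w).

Definition critical_poly x y : {poly R} :=
  ('X - x%:P) * \prod_(i < k) ('X - (a i)%:P)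
  - ('X - x%:P + 1 - y%:P) * \prod_(i < k) ('X - (b i)%:P).

Definition turning_point w : Prop :=
  mup w (critical_poly (chi w) (eta w)) = 3%N.

Definition polygon_interior : set (R * R) :=
  [set z | [/\ 0 < z.2 < 1,
               forall i, i = 0%N :> nat -> a i + 1 - z.2 < z.1,
               forall i, i.+1 = k -> z.1 < b i
             & forall i, ~ (a i + 1 - z.2 <= z.1 <= b i)]].

(* The sides of the polygon, each given by its two endpoints.  The lines
   chi = b_i and chi + eta = a_i + 1 meet at (b_i, 1 - (b_i - a_i)). *)
Definition diagonal_side i : (R * R) * (R * R) :=
  (if i == 0%N :> nat then (a i + 1, 0) else (a i, 1), (b i, 1 - (b i - a i))).

Definition vertical_side i : (R * R) * (R * R) :=
  ((b i, 1 - (b i - a i)), (b i, if i.+1 == k then 0 else 1)).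

Definition top_side i j : (R * R) * (R * R) := ((b i, 1), (a j, 1)).

Definition bottom_side i j : (R * R) * (R * R) := ((a i + 1, 0), (b j, 0)).

End FrozenBoundary.

Section Tangency.
Context {R : realType}.
Implicit Types (z u v : R * R) (s : (R * R) * (R * R)) (F : set_system R).

Definition cross u v : R := u.1 * v.2 - u.2 * v.1.

Definition line_through s : set (R * R) :=
  [set z | cross (z - s.1) (s.2 - s.1) = 0].

Definition segment s : set (R * R) :=
  [set z | exists2 t : R, 0 <= t <= 1 &
     z = ((1 - t) * s.1.1 + t * s.2.1, (1 - t) * s.1.2 + t * s.2.2)].

Definition boundary_segment (U : set (R * R)) s : Prop :=
  s.1 <> s.2 /\ segment s `<=` closure U `\` U°.

(* Along the filter F the curve g tends to z, and the direction of the secants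
   from z tends to that of v.  This also makes sense at a cusp, where the
   velocity of g vanishes, and at infinite values of the parameter. *)
Definition tangent_direction F (g : R -> R * R) z v : Prop :=
  [/\ g x @[x --> F] --> z,
      \forall x \near F, g x <> z
    & cross (g x - z) v / `|g x - z| @[x --> F] --> (0 : R)].

Definition tangent_to_line F (g : R -> R * R) s : Prop :=
  exists2 z, line_through s z & tangent_direction F g z (s.2 - s.1).

Definition tangent_to_segment F (g : R -> R * R) s : Prop :=
  exists2 z, segment s z & tangent_direction F g z (s.2 - s.1).

End Tangency.

(* Main.v *)
Require Import Defs.
From mathcomp Require Import all_boot all_order all_algebra ring lra.
From mathcomp Require Import all_classical all_reals all_analysis.
From mathcomp Require polyrcf.

(* Put A = prod ('X - a_i), B = prod ('X - b_i) and D = A - B.  The critical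
   equation reads (w - chi) D(w) = (1 - eta) B(w), a family of lines in the
   (chi, eta) plane whose envelope is
     chi = w - B D / W,  1 - eta = D^2 / W,  with W = B' D - B D'.
   By interlacing, D has one simple root h_j in each gap (b_{j-1}, a_j), and
   B / D = w - e - sum_j d_j / (w - h_j) with all d_j > 0.  Multiplying out the
   denominators, with D_j = D / ('X - h_j),
     W = D^2 + sum_j d_j D_j^2 > 0  and  V := sum_j d_j D_j^3
   satisfy chi' = - 2 V B / W^2 and eta' = - 2 V D / W^2, so that the slope is
   B / D and the cusps are the zeros of V.  Between consecutive h_j the function
   V / D^3 = sum_j d_j / (w - h_j)^3 decreases strictly from +oo to -oo. *)

Set Implicit Arguments.
Unset Strict Implicit.
Unset Printing Implicit Defensive.

Import Order.TTheory GRing.Theory Num.Theory.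
Import numFieldNormedType.Exports.

Local Open Scope classical_set_scope.
Local Open Scope ring_scope.

(** * Polynomial identities for [B / D] in partial fractions *)

Section PartialFractions.
Context {R : realFieldType} {I : finType}.
Variables (h d : I -> R) (e : R).
Hypotheses (h_inj : injective h) (d_gt0 : forall i, 0 < d i).

(** The formulas for [chi] and [eta] divide by zero at the [a i] and [b i], which are points of
    tangency, and the slope becomes infinite at the [h j]. In terms of [h], [d], [e] the curve has
    the single denominator [W], which has no real zero. It is therefore smooth on the whole line,
    and the values prescribed as limits are ordinary values.

    Positivity of the [d j] does more than give [W > 0]: it also makes the root at a cusp exactly
    triple, and it turns the behaviour at [-oo] into termwise inequalities, so that no change of
    parameter is needed there.

    The condition that the lengths sum to 1 makes [D] monic of degree [k - 1], so its [k - 1] roots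
    in the gaps determine it.

    Tangency has to hold even if [V] vanishes at the point of contact, where the velocity is zero.
    It is thus proved for secants; the factor [V] common to both derivatives cancels in the quotient
    used by l'Hopital's rule. *)

Definition nodeP : {poly R} := \prod_i ('X - (h i)%:P).
Definition cofP i : {poly R} := \prod_(j | j != i) ('X - (h j)%:P).
Definition numP : {poly R} := ('X - e%:P) * nodeP - \sum_i d i *: cofP i.
Definition wronP : {poly R} := nodeP ^+ 2 + \sum_i d i *: cofP i ^+ 2.
Definition cuspP : {poly R} := \sum_i d i *: cofP i ^+ 3.

Local Notation D := nodeP.
Local Notation B := numP.
Local Notation W := wronP.
Local Notation V := cuspP.

Lemma nodeP_cof i : D = ('X - (h i)%:P) * cofP i.
Proof. by rewrite /D /nodeP (bigD1 i). Qed.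

Lemma root_nodeP i : D.[h i] = 0.
Proof. by rewrite (nodeP_cof i) hornerM !hornerE subrr mul0r. Qed.

Lemma nodeP_eq0 w : D.[w] = 0 -> exists i, w = h i.
Proof.
rewrite /D /nodeP horner_prod => /eqP; rewrite prodf_seq_eq0 => /hasP[i _ /=].
by rewrite !hornerE subr_eq0 => /eqP ->; exists i.
Qed.

Lemma horner_cof i w : (cofP i).[w] = \prod_(j | j != i) (w - h j).
Proof. by rewrite horner_prod; apply: eq_bigr => j _; rewrite !hornerE. Qed.

Lemma cof_root_neq0 i : (cofP i).[h i] != 0.
Proof.
rewrite horner_cof; apply/prodf_neq0 => j ji; rewrite subr_eq0.
by apply: contraNneq ji => /h_inj ->.
Qed.

Lemma cof_root_eq0 i j : i != j -> (cofP i).[h j] = 0.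
Proof.
move=> ij; rewrite horner_cof (bigD1 j) 1?eq_sym//=.
by rewrite subrr mul0r.
Qed.

(** This is the quotient rule for [D / cofP i = 'X - h i], whose derivative is 1. *)
Lemma deriv_cof i : D^`() * cofP i - D * (cofP i)^`() = cofP i ^+ 2.
Proof. by rewrite (nodeP_cof i) derivM derivXsubC; ring. Qed.

Lemma horner_num w : B.[w] = (w - e) * D.[w] - \sum_i d i * (cofP i).[w].
Proof.
rewrite /B /numP !hornerE horner_sum.
by congr (_ - _); apply: eq_bigr => i _; rewrite hornerZ.
Qed.

Lemma horner_wron w : W.[w] = D.[w] ^+ 2 + \sum_i d i * (cofP i).[w] ^+ 2.
Proof.
rewrite /W /wronP !hornerE horner_sum.
by congr (_ + _); apply: eq_bigr => i _; rewrite !hornerE.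
Qed.

Lemma horner_cusp w : V.[w] = \sum_i d i * (cofP i).[w] ^+ 3.
Proof. by rewrite horner_sum; apply: eq_bigr => i _; rewrite !hornerE. Qed.

(** Off the nodes the square of [D] is positive; at a node [h i] the [i]-th weighted square
    survives, because the nodes are distinct. *)
Lemma wron_gt0 w : 0 < W.[w].
Proof.
rewrite horner_wron.
have s0 : 0 <= \sum_i d i * (cofP i).[w] ^+ 2.
  by apply: sumr_ge0 => i _; rewrite mulr_ge0 ?sqr_ge0// ltW.
have [Dw|Dw] := eqVneq D.[w] 0; last first.
  by rewrite ltr_wpDr// lt_neqAle sqr_ge0 eq_sym sqrf_eq0 Dw.
have [i ->] := nodeP_eq0 Dw.
rewrite ltr_wpDl ?sqr_ge0// (bigD1 i)//= ltr_wpDr//.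
  by apply: sumr_ge0 => j _; rewrite mulr_ge0 ?sqr_ge0// ltW.
by rewrite mulr_gt0// exprn_even_gt0// cof_root_neq0.
Qed.

Lemma num_root i : B.[h i] = - (d i * (cofP i).[h i]).
Proof.
rewrite horner_num root_nodeP mulr0 sub0r (bigD1 i)//= big1 ?addr0// => j ji.
by rewrite cof_root_eq0// mulr0.
Qed.

Lemma cusp_root i : V.[h i] = d i * (cofP i).[h i] ^+ 3.
Proof.
rewrite horner_cusp (bigD1 i)//= big1 ?addr0// => j ji.
by rewrite cof_root_eq0// expr0n mulr0.
Qed.

Lemma cusp_root_neq0 w : D.[w] = 0 -> V.[w] != 0.
Proof.
move=> /nodeP_eq0[i ->]; rewrite cusp_root mulf_neq0//.
  by rewrite gt_eqF.
by rewrite expf_neq0// cof_root_neq0.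
Qed.

Lemma wronE : B^`() * D - B * D^`() = W.
Proof.
have dS : (\sum_i d i *: cofP i)^`() = \sum_i d i *: (cofP i)^`().
  by rewrite raddf_sum/=; apply: eq_bigr => i _; rewrite derivZ.
rewrite /B /numP derivB derivM derivXsubC dS -/D /W /wronP -/D.
have -> : \sum_i d i *: cofP i ^+ 2 =
    (\sum_i d i *: cofP i) * D^`() - (\sum_i d i *: (cofP i)^`()) * D.
  rewrite !mulr_suml -sumrB; apply: eq_bigr => i _.
  by rewrite -deriv_cof scalerBr -!scalerAl [D * _]mulrC [_ * cofP i]mulrC.
ring.
Qed.

(** Since [W / D ^+ 2] is 1 plus the sum of the [d i / (w - h i) ^+ 2], its derivative is
    [- 2 * V / D ^+ 3]; the identity is this derivative with denominators cleared. *)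
Lemma deriv_wron : 2 * D^`() * W - D * W^`() = 2 * V.
Proof.
have -> : W^`() = 2 * D * D^`() + \sum_i d i *: (2 * cofP i * (cofP i)^`()).
  rewrite /W /wronP derivD raddf_sum/= -/D; congr (_ + _).
    by rewrite expr2 derivM -mulrA mulr_natl mulr2n; congr (_ + _); rewrite mulrC.
  apply: eq_bigr => i _; rewrite derivZ expr2 derivM -mulrA mulr_natl mulr2n.
  by congr (_ *: (_ + _)); rewrite mulrC.
rewrite /W /wronP -/D.
have -> : 2 * V = 2 * D^`() * (\sum_i d i *: cofP i ^+ 2)
  - D * (\sum_i d i *: (2 * cofP i * (cofP i)^`())).
  rewrite /V /cuspP !mulr_sumr -sumrB; apply: eq_bigr => i _.
  rewrite -!scalerAr -scalerBr; congr (_ *: _).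
  have -> : cofP i ^+ 3 = cofP i * (D^`() * cofP i - D * (cofP i)^`()).
    by rewrite deriv_cof exprS.
  by ring.
ring.
Qed.

Definition chiQ w : R := w - B.[w] * D.[w] / W.[w].
Definition etaQ w : R := 1 - D.[w] ^+ 2 / W.[w].

(** Up to the constant [W.[w]], this is the quotient of the critical polynomial by its double root
    [w]. Its value at [w] is [V.[w]]. *)
Definition critQ w : {poly R} := \sum_i (d i * (cofP i).[w] ^+ 2) *: cofP i.

(** Divided by [D.[w]] and [D], this is the difference of [1 / (w - h i)] and [1 / ('X - h i)].
    Every factor ['X - w] extracted below comes from it. *)
Lemma cof_shift i w : (cofP i).[w] *: D - D.[w] *: cofP i =
  ((cofP i).[w] *: cofP i) * ('X - w%:P).
Proof.
rewrite (nodeP_cof i) !hornerE -!mul_polyC polyCM polyCB; ring.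
Qed.

Lemma critical_factor w :
  W.[w] *: (('X - (chiQ w)%:P) * D - (1 - etaQ w) *: B) =
  ('X - w%:P) ^+ 2 * critQ w.
Proof.
have W0 := wron_gt0 w; have Wn0 : W.[w] != 0 by rewrite gt_eqF.
pose T : {poly R} := \sum_i (d i * (cofP i).[w]) *: cofP i.
(* The divided difference of [B / D] between [w] and ['X] yields the first factor ['X - w]; [WT]
   yields the second. *)
have BD : B.[w] *: D - D.[w] *: B = - (('X - w%:P) * (D.[w] *: D + T)).
  rewrite horner_num /B /numP -/D.
  have -> : ('X - w%:P) * (D.[w] *: D + T) = D.[w] *: (('X - w%:P) * D) +
      \sum_i d i *: ((cofP i).[w] *: D - D.[w] *: cofP i).
    rewrite mulrDr -scalerAr; congr (_ + _).
    rewrite /T mulr_sumr; apply: eq_bigr => i _; rewrite cof_shift.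
    by rewrite mulrC -scalerAl -scalerAl scalerA.
  have -> : \sum_i d i *: ((cofP i).[w] *: D - D.[w] *: cofP i) =
      (\sum_i d i * (cofP i).[w]) *: D - D.[w] *: \sum_i d i *: cofP i.
    rewrite scaler_suml scaler_sumr -sumrB; apply: eq_bigr => i _.
    by rewrite scalerBr !scalerA [D.[w] * _]mulrC.
  by rewrite scalerBl -!mul_polyC polyCM polyCB; ring.
have WT : W.[w] *: D - D.[w] ^+ 2 *: D - D.[w] *: T = ('X - w%:P) * critQ w.
  rewrite horner_wron scalerDl [X in X - _]addrC addKr scaler_suml /T scaler_sumr.
  rewrite -sumrB /critQ mulr_sumr; apply: eq_bigr => i _.
  transitivity ((d i * (cofP i).[w]) *:
      ((cofP i).[w] *: D - D.[w] *: cofP i)).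
    by rewrite -!mul_polyC !(polyCM, rmorphXn)/=; ring.
  by rewrite cof_shift -!mul_polyC !(polyCM, rmorphXn)/=; ring.
have -> : W.[w] *: (('X - (chiQ w)%:P) * D - (1 - etaQ w) *: B) =
    ('X - w%:P) * (W.[w] *: D) + D.[w] *: (B.[w] *: D - D.[w] *: B).
  rewrite scalerBr scalerA.
  have -> : W.[w] * (1 - etaQ w) = D.[w] ^+ 2 by rewrite /etaQ; field.
  rewrite scalerAl scalerBr.
  have -> : W.[w] *: (chiQ w)%:P = (W.[w] * w - B.[w] * D.[w])%:P.
    by rewrite -mul_polyC -polyCM /chiQ; congr _%:P; field.
  by rewrite -!mul_polyC; ring.
by rewrite BD expr2 -mulrA -WT -!mul_polyC; ring.
Qed.

(** When [V.[w]] vanishes, this exhibits a third factor ['X - w]. The sum left over takes at [w] the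
    value of the sum of the [d i * (cofP i).[w] ^+ 4], which bounds the multiplicity. *)
Lemma critical_cofactor w : D.[w] *: critQ w =
  V.[w] *: D - ('X - w%:P) * \sum_i (d i * (cofP i).[w] ^+ 3) *: cofP i.
Proof.
rewrite /critQ horner_cusp scaler_suml mulr_sumr scaler_sumr -sumrB.
apply: eq_bigr => i _.
transitivity ((d i * (cofP i).[w] ^+ 3) *: D -
    (d i * (cofP i).[w] ^+ 2) *: ((cofP i).[w] *: D - D.[w] *: cofP i)).
  by rewrite -!mul_polyC !(polyCM, rmorphXn)/=; ring.
by rewrite cof_shift -!mul_polyC !(polyCM, rmorphXn)/=; ring.
Qed.

(** By [critical_factor] the multiplicity is 2 plus that of [critQ w] at [w]. The latter is zero
    unless [V.[w] = 0], and is then exactly one, the remaining sum of fourth powers being positive;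
    [i0] makes this sum nonempty. *)
Lemma mup_critical (i0 : I) w :
  mup w (('X - (chiQ w)%:P) * D - (1 - etaQ w) *: B) = 3%N <-> V.[w] = 0.
Proof.
have W0 : W.[w] != 0 by rewrite gt_eqF ?wron_gt0.
have mupZ c p : c != 0 -> mup w (c *: p) = mup w p.
  by move=> c0; rewrite -mul_polyC mupMr// rootC.
rewrite -(mupZ W.[w])// critical_factor.
have QV : (critQ w).[w] = V.[w].
  rewrite horner_sum horner_cusp; apply: eq_bigr => i _.
  by rewrite hornerZ -mulrA -exprSr.
have [V0|V0] := eqVneq V.[w] 0; last first.
  rewrite mupMl ?mup_XsubCX ?eqxx//; last by rewrite /root QV.
  by split=> // /eqP; rewrite (negbTE V0).
(* A zero of [V] is never a node, so [critical_cofactor] can be divided by [D.[w]]. *)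
have D0 : D.[w] != 0 by apply: contra_eq_neq V0 => /cusp_root_neq0.
split=> // _.
have := critical_cofactor w; rewrite V0 scale0r sub0r.
set S := \sum_i _ => DQ.
have {DQ} -> : critQ w = - D.[w]^-1 *: (('X - w%:P) * S).
  by rewrite scaleNr -scalerN -DQ scalerA mulVf// scale1r.
rewrite -scalerAr mupZ ?oppr_eq0 ?invr_eq0// mulrA -exprSr mupMl ?mup_XsubCX ?eqxx//.
rewrite /root horner_sum.
have c0 j : (cofP j).[w] != 0.
  by apply: contraNneq D0; rewrite (nodeP_cof j) hornerM => ->; rewrite mulr0.
rewrite (bigD1 i0)//= hornerZ gt_eqF// ltr_wpDr//.
  apply: sumr_ge0 => j _; rewrite hornerZ -mulrA -exprSr.
  by apply: mulr_ge0; [exact: ltW|exact: exprn_even_ge0].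
rewrite -mulrA -exprSr; apply: mulr_gt0; first exact: d_gt0.
by rewrite exprn_even_gt0//= c0.
Qed.

End PartialFractions.

(** * Analytic tools: quotients of polynomials, the mean value theorem, tangency *)

Section RealLemmas.
Context {R : realType}.
Implicit Types (f g : R -> R) (p q : {poly R}) (w : R).

Lemma horner_near_neq0 p w : p != 0 -> \forall x \near w^', p.[x] != 0.
Proof.
move=> p0; have [m [q]] := multiplicity_XsubC p w.
rewrite p0/= => qw ->.
have : \forall x \near w, q.[x] != 0.
  by have := @continuous_horner R q w => /cvgr_neq0; exact.
move=> /nbhs_dnbhs; apply: filter_app; near=> x => qx.
rewrite !hornerE mulf_neq0// expf_neq0// subr_eq0.
by near: x; exact: nbhs_dnbhs_neq.
Unshelve. all: by end_near. Qed.

Lemma is_derive_horner_div p q w : q.[w] != 0 ->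
  is_derive w 1 (fun x => p.[x] / q.[x])
    ((p^`().[w] * q.[w] - p.[w] * q^`().[w]) / q.[w] ^+ 2).
Proof.
move=> q0; have dV := is_deriveV q0 (is_derive_poly q w).
have := @is_deriveM _ _ (horner p) (fun x => (q.[x])^-1) w 1 _ _ (is_derive_poly p w) dV.
by move=> /is_derive_eq; apply; rewrite /GRing.scale/=; field.
Qed.

Lemma cvg_horner_div p q w : q.[w] != 0 ->
  (p.[x] / q.[x]) @[x --> w] --> p.[w] / q.[w].
Proof.
by move=> q0; apply: cvgM; [|apply: cvgV => //]; exact: continuous_horner.
Qed.

(** The mean value theorem is applied on each side of [w]. The derivative may vanish at [w] itself,
    which covers cusps. *)
Lemma near_neq_of_derive (f df : R -> R) w :
  (forall x : R, is_derive x 1 f (df x)) -> (\forall x \near w^', df x != 0) ->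
  \forall x \near w^', f x != f w.
Proof.
move=> fdf /nbhs_ballP[r /= r0 rdf].
have cf (x y : R) : {within `[x, y], continuous f}.
  apply: continuous_subspaceT => z; apply/differentiable_continuous.
  by apply/derivable1_diffP; apply: ex_derive.
have step x y : x < y -> (forall c, x < c < y -> df c != 0) -> f y != f x.
  move=> xy dfn0; have [c] := MVT xy (fun c _ => fdf c) (@cf x y).
  rewrite in_itv/= => /dfn0 dfc E; rewrite -subr_eq0 E mulf_neq0// subr_eq0.
  by rewrite gt_eqF.
near=> x; have xw : x != w by near: x; exact: nbhs_dnbhs_neq.
have xr : ball w r x.
  by near: x; apply: nbhs_dnbhs; exact: nbhsx_ballx.
have dfr c : c != w -> `|w - c| <= `|w - x| -> df c != 0.
  by move=> cw cx; apply: rdf => //=; exact: le_lt_trans xr.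
case: (ltgtP w x) => [wx|wx|wx]; last by rewrite wx eqxx in xw.
  apply: step => // c /andP[wc cx]; apply: dfr; first by rewrite gt_eqF.
  by rewrite !ler0_norm; lra.
rewrite eq_sym; apply: step => // c /andP[xc cw]; apply: dfr; first by rewrite lt_eqF.
by rewrite !ger0_norm; lra.
Unshelve. all: by end_near. Qed.

(** Replacing the norm of the secant by a smaller nonzero scalar [E], in practice one coordinate of
    the secant, only enlarges the quotient and makes it accessible to l'Hopital's rule. *)
Lemma tangent_directionI (F : set_system R) {FF : Filter F} (g : R -> R * R) (z v : R * R)
    (E : R -> R) :
  g x @[x --> F] --> z -> (\forall x \near F, E x != 0) ->
  (forall x, `|E x| <= `|g x - z|) ->
  cross (g x - z) v / E x @[x --> F] --> (0 : R) ->
  tangent_direction F g z v.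
Proof.
move=> gz E0 Eg cE; split => //.
  apply: filterS E0 => x; apply: contraNnot => gxz.
  by rewrite -normr_le0 (le_trans (Eg x))// gxz subrr normr0.
apply/cvgr0Pnorm_lt => e e0; move/cvgr0Pnorm_lt : cE => /(_ e e0).
apply: filter_app; apply: filterS E0 => x Ex; apply: le_lt_trans.
rewrite !normrM ler_wpM2l// normrV ?unitfE//; last first.
  by rewrite normr_eq0 -normr_gt0 (lt_le_trans _ (Eg x))// normr_gt0.
rewrite normrV ?unitfE// normr_id lef_pV2 ?posrE ?normr_gt0//.
by rewrite -normr_gt0 (lt_le_trans _ (Eg x))// normr_gt0.
Qed.

End RealLemmas.

(** * Derivatives and tangents of the envelope curve *)

Section Envelope.
Context {R : realType} {I : finType}.
Variables (h d : I -> R) (e : R).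
Hypotheses (h_inj : injective h) (d_gt0 : forall i, 0 < d i).
Variable i0 : I.

Local Notation D := (nodeP h).
Local Notation B := (numP h d e).
Local Notation W := (wronP h d).
Local Notation V := (cuspP h d).
Local Notation chiq := (chiQ h d e).
Local Notation etaq := (etaQ h d).

Let Wn0 w : W.[w] != 0.
Proof. by rewrite gt_eqF ?wron_gt0. Qed.

Definition dchiQ w : R := - (2 * V.[w] * B.[w] / W.[w] ^+ 2).
Definition detaQ w : R := - (2 * V.[w] * D.[w] / W.[w] ^+ 2).

Lemma horner_wronE w :
  W.[w] = B^`().[w] * D.[w] - B.[w] * D^`().[w].
Proof. by rewrite -(wronE h d e) !hornerE. Qed.

Lemma horner_deriv_wron w :
  2 * D^`().[w] * W.[w] - D.[w] * W^`().[w] = 2 * V.[w].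
Proof.
have := deriv_wron h d => /(congr1 (fun p => p.[w])).
by rewrite !hornerE.
Qed.

Lemma is_derive_chiQ (w : R) : is_derive w 1 chiq (dchiQ w).
Proof.
rewrite /chiQ /dchiQ.
move: (Wn0 w) (horner_wronE w) (horner_deriv_wron w).
move: B D W V => b dd w0 v Wn E1 E2.
have := is_derive_horner_div (b * dd) Wn.
under [X in is_derive _ _ X _]eq_fun do rewrite hornerM.
move=> H; have := is_deriveB (is_derive_id w 1) H.
move=> /is_derive_eq; apply; rewrite derivM !hornerE.
have -> : b^`().[w] * dd.[w] = w0.[w] + b.[w] * dd^`().[w] by rewrite E1; ring.
by rewrite -E2; field.
Qed.

Lemma is_derive_etaQ (w : R) : is_derive w 1 etaq (detaQ w).
Proof.
rewrite /etaQ /detaQ.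
move: (Wn0 w) (horner_deriv_wron w); move: D W V => dd w0 v Wn E2.
have := is_derive_horner_div (dd * dd) Wn.
under [X in is_derive _ _ X _]eq_fun do rewrite hornerM -expr2.
move=> H; have := is_deriveB (is_derive_cst (1 : R) w 1) H.
move=> /is_derive_eq; apply.
rewrite sub0r derivM !hornerE; congr (- (_ / _)).
by rewrite -E2; ring.
Qed.

Lemma continuous_chiQ : continuous chiq.
Proof.
move=> w; apply/differentiable_continuous/derivable1_diffP.
by case: (is_derive_chiQ w).
Qed.

Lemma continuous_etaQ : continuous etaq.
Proof.
move=> w; apply/differentiable_continuous/derivable1_diffP.
by case: (is_derive_etaQ w).
Qed.

Lemma cuspP_neq0 : V != 0.
Proof.
have /(_ (h i0)) := cusp_root_neq0 h_inj d_gt0; rewrite root_nodeP => /(_ erefl).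
by apply: contraNneq => ->; rewrite horner0.
Qed.

Lemma nodeP_neq0 : D != 0.
Proof. by rewrite /nodeP prodf_seq_neq0; apply/allP => i _; rewrite polyXsubC_eq0. Qed.

(** The quotient of derivatives equals [B / D] only where [V] is nonzero. The zeros of [V] are
    isolated, so the limit exists at cusps too. *)
Lemma cvg_slope w : D.[w] != 0 ->
  dchiQ x / detaQ x @[x --> w^'] --> B.[w] / D.[w].
Proof.
move=> D0; have : B.[x] / D.[x] @[x --> w^'] --> B.[w] / D.[w].
  by apply: cvg_within_filter; exact: cvg_horner_div.
apply: cvg_trans; apply: near_eq_cvg; near=> x.
have Vx : V.[x] != 0 by near: x; exact/horner_near_neq0/cuspP_neq0.
have Dx : D.[x] != 0 by near: x; exact/horner_near_neq0/nodeP_neq0.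
by rewrite /dchiQ /detaQ; field; rewrite Vx Dx Wn0.
Unshelve. all: by end_near. Qed.

Definition curveQ w : R * R := (chiq w, etaq w).

Let cvg_curveQ w : curveQ x @[x --> w^'] --> curveQ w.
Proof.
apply: cvg_within_filter.
exact: (cvg_pair (@continuous_chiQ w) (@continuous_etaQ w)).
Qed.

(* [C] is one of B, D, so that [E] is one of the two coordinates.  The secants
   are handled by l'Hopital's rule, which does not exclude cusps. *)
Lemma tangent_curveQ w (v : R * R) (C : {poly R}) (E : R -> R) :
  v.1 * D.[w] = v.2 * B.[w] -> C.[w] != 0 ->
  (forall x : R, is_derive x 1 E (- (2 * V.[x] * C.[x] / W.[x] ^+ 2))) ->
  (forall x, `|E x - E w| <= `|curveQ x - curveQ w|) ->
  tangent_direction w^' curveQ (curveQ w) v.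
Proof.
move=> vw C0 dE Eg; pose dEx x := - (2 * V.[x] * C.[x] / W.[x] ^+ 2).
have Cn0 : C != 0 by apply: contraNneq C0 => ->; rewrite horner0.
have nV : \forall x \near w^', V.[x] != 0 by exact/horner_near_neq0/cuspP_neq0.
have nC : \forall x \near w^', C.[x] != 0 by exact/horner_near_neq0.
have dE0 : \forall x \near w^', dEx x != 0.
  near=> x; rewrite /dEx oppr_eq0 mulf_neq0 ?invr_eq0 ?expf_neq0//.
  apply: mulf_neq0; last by near: x.
  by rewrite mulf_neq0 ?pnatr_eq0//; near: x.
apply: (tangent_directionI (E := fun x => E x - E w)) => //.
  by near=> x; rewrite subr_eq0; near: x; exact: near_neq_of_derive dE0.
pose dc x := - (2 * V.[x] * (B.[x] * v.2 - D.[x] * v.1) / W.[x] ^+ 2).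
pose N x : R := (chiq x - chiq w) * v.2 - (etaq x - etaq w) * v.1.
have dcross (x : R) : is_derive x 1 N (dc x).
  have d1 := is_deriveB (is_derive_chiQ x) (is_derive_cst (chiq w) x 1).
  have d2 := is_deriveB (is_derive_etaQ x) (is_derive_cst (etaq w) x 1).
  have := is_deriveB (is_deriveM d1 (is_derive_cst v.2 x 1))
    (is_deriveM d2 (is_derive_cst v.1 x 1)).
  by move=> /is_derive_eq; apply; rewrite /dc /dchiQ /detaQ /GRing.scale/=; ring.
have dE' (x : R) : is_derive x 1 (fun x => E x - E w) (dEx x).
  have := is_deriveB (dE x) (is_derive_cst (E w) x 1).
  by move=> /is_derive_eq; apply; rewrite subr0.
have contE : {for w, continuous (fun x => E x - E w)}.
  by apply/differentiable_continuous/derivable1_diffP; case: (dE' w).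
have contc : {for w, continuous N}.
  by apply/differentiable_continuous/derivable1_diffP; case: (dcross w).
have /nbhs_ballP[r /= r0 rdE] : \forall x \near w, x != w -> dEx x != 0 := dE0.
have inr x : (x \in `]w - r, w + r[%classic `\ w) -> x != w /\ ball w r x.
  rewrite inE/= in_itv/= => -[/andP[x1 x2] xw]; split; first exact/eqP.
  by rewrite /ball/= ltr_distlC; apply/andP; split; lra.
apply: (@lhopital R N dc
  (fun x => E x - E w) dEx (w - r) (w + r) w 0).
- by rewrite in_itv/=; lra.
- have -> : 0 = N w by rewrite /N !subrr !mul0r subrr.
  exact: contc.
- have -> : 0 = E w - E w by rewrite subrr.
  exact: contE.
- by move=> x /inr[xw xr]; exact: rdE.
(* [q] is what remains of [dc / dEx] once the common factor [2 * V / W ^+ 2] is cancelled; it tends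
   to 0 because [v] is parallel to [(B.[w], D.[w])]. *)
pose q x := (B.[x] * v.2 - D.[x] * v.1) / C.[x].
have cq : q x @[x --> w] --> (0 : R).
  have := @cvg_horner_div R (v.2 *: B - v.1 *: D) _ _ C0.
  rewrite hornerD hornerN !hornerZ -vw subrr mul0r; apply: cvg_trans; apply: near_eq_cvg.
  by near=> x; rewrite /q hornerD hornerN !hornerZ [v.2 * _]mulrC [v.1 * _]mulrC.
apply/cvgr0Pnorm_lt => eps eps0; move/cvgr0Pnorm_lt : cq => /(_ _ eps0).
apply: filterS => x; apply: le_lt_trans.
(* Where [dEx] vanishes, for instance at [w] when it is a cusp, the quotient is 0 by the convention
   [0^-1 = 0]. *)
have [->|dx0] := eqVneq (dEx x) 0; first by rewrite invr0 mulr0 normr0.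
suff -> : dc x / dEx x = q x by [].
rewrite /dc /dEx /q; field.
move: dx0; rewrite /dEx oppr_eq0 mulf_eq0 mulf_eq0 !negb_or => /andP[/andP[]].
by rewrite mulf_eq0 negb_or => /andP[_ ->] -> _; rewrite Wn0.
Unshelve. all: by end_near. Qed.

(** [B] and [D] have no common zero, so one of the coordinates [chiq] and [etaq] always serves as
    the scalar [E]. *)
Lemma tangent_directionQ w (v : R * R) : v.1 * D.[w] = v.2 * B.[w] ->
  tangent_direction w^' curveQ (curveQ w) v.
Proof.
move=> vw; have [D0|D0] := eqVneq D.[w] 0.
  apply: (@tangent_curveQ w v B chiq) => //.
  - have [i ->] := nodeP_eq0 D0.
    rewrite num_root// oppr_eq0; apply: mulf_neq0; last exact: cof_root_neq0.
    by rewrite gt_eqF.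
  - exact: is_derive_chiQ.
  - by move=> x; rewrite prod_normE/= le_max lexx.
apply: (@tangent_curveQ w v D etaq) => //; first exact: is_derive_etaQ.
by move=> x; rewrite prod_normE/= le_max lexx orbT.
Qed.

(** * The curve at [-oo] *)

Let Wgt0 w : 0 < W.[w]. Proof. exact: wron_gt0. Qed.

Let S w := \sum_i d i * (cofP h i).[w] ^+ 2.

Lemma etaQE w : etaq w = S w / W.[w].
Proof.
have := horner_wron h d w; rewrite -/(S w) /etaQ => E.
have Wn : W.[w] != 0 by rewrite gt_eqF.
have -> : S w = W.[w] - D.[w] ^+ 2 by rewrite E; ring.
by field.
Qed.

Lemma horner_nodeP_cof i w : D.[w] = (w - h i) * (cofP h i).[w].
Proof. by rewrite (nodeP_cof h i) hornerM !hornerE. Qed.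

(** [chiq - e] and [etaq] are sums with the same nonnegative weights [d i * (cofP h i).[w] ^+ 2], so
    they can be compared term by term. *)
Lemma chiQE w :
  chiq w - e = (\sum_i d i * (cofP h i).[w] ^+ 2 * (2 * w - e - h i)) / W.[w].
Proof.
have Wn : W.[w] != 0 by rewrite gt_eqF.
apply: (mulIf Wn); rewrite divfK// /chiQ.
have -> : (w - B.[w] * D.[w] / W.[w] - e) * W.[w] =
  (w - e) * W.[w] - B.[w] * D.[w] by field.
rewrite horner_wron horner_num -/(S w).
transitivity ((w - e) * S w + \sum_i d i * (cofP h i).[w] * D.[w]).
  by rewrite -mulr_suml; ring.
rewrite /S mulr_sumr -big_split/=; apply: eq_bigr => i _.
by rewrite (horner_nodeP_cof i); ring.
Qed.

Lemma etaQ_gt0 w : D.[w] != 0 -> 0 < etaq w.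
Proof.
move=> D0; rewrite etaQE divr_gt0// /S (bigD1 i0)//=.
apply: ltr_wpDr.
  by apply: sumr_ge0 => i _; apply: mulr_ge0; [exact: ltW|exact: sqr_ge0].
apply: mulr_gt0 => //; rewrite exprn_even_gt0//=.
by apply: contraNneq D0 => c0; rewrite (horner_nodeP_cof i0) c0 mulr0.
Qed.

(** Below [- 2 * M] the parameter lies left of all nodes, and [w] dominates [e + h i]. The factor 2
    gives [|h i| <= |w| / 2], hence the factor 4 in the last bound of [M_bnd]. *)
Let M := 1 + `|e| + \sum_i `|h i|.

Let M_bnd w i : w < - 2 * M ->
  [/\ w < -1, w < h i, 3 * w <= 2 * w - e - h i <= w &
      w ^+ 2 <= 4 * (w - h i) ^+ 2].
Proof.
have H : `|h i| <= \sum_i `|h i|.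
  by rewrite (bigD1 i)//= lerDl; apply: sumr_ge0.
have /andP[e1 e2] : - `|e| <= e <= `|e| by rewrite -ler_norml.
have /andP[h1 h2] : - `|h i| <= h i <= `|h i| by rewrite -ler_norml.
rewrite /M => Hw.
have P1 : 0 <= (w - 2 * (w - h i)) * (- w - 2 * (w - h i)) by apply: mulr_ge0; lra.
split; [lra|lra|lra|]; nra.
Qed.

Let K := 4 * \sum_i d i.

(** Dropping the weighted squares from [W] bounds [etaq] by the sum of the [d i / (w - h i) ^+ 2],
    of order [w ^- 2]. As [chiq - e] lies between two multiples of [w * etaq], it tends to 0 while
    [etaq / (chiq - e)] is of order [1 / w]: the tangent at [-oo] is horizontal. *)
Let bounds w : w < - 2 * M ->
  [/\ w < -1, 0 < etaq w, etaq w * w ^+ 2 <= K,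
      3 * w * etaq w <= chiq w - e & chiq w - e <= w * etaq w].
Proof.
move=> wM; have Wn : W.[w] != 0 by rewrite gt_eqF.
have [w1 _ _ _] := M_bnd i0 wM.
have D0 : D.[w] != 0.
  by apply/eqP => /nodeP_eq0[i E]; have [_] := M_bnd i wM; rewrite E ltxx.
have c2 i : 0 <= d i * (cofP h i).[w] ^+ 2.
  by apply: mulr_ge0; [exact: ltW|exact: sqr_ge0].
split => //; first exact: etaQ_gt0.
- rewrite etaQE -mulrAC ler_pdivrMr//.
  apply: (@le_trans _ _ (K * D.[w] ^+ 2)); last first.
    rewrite ler_wpM2l//; last by rewrite horner_wron lerDl sumr_ge0.
    by rewrite /K mulr_ge0// sumr_ge0// => i _; exact: ltW.
  rewrite /S /K mulr_suml mulr_sumr mulr_suml; apply: ler_sum => i _.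
  rewrite (horner_nodeP_cof i).
  have -> : 4 * d i * ((w - h i) * (cofP h i).[w]) ^+ 2 =
    d i * (cofP h i).[w] ^+ 2 * (4 * (w - h i) ^+ 2) by ring.
  by rewrite ler_wpM2l//; have [] := M_bnd i wM.
- rewrite etaQE chiQE mulrA ler_pM2r ?invr_gt0// /S mulr_sumr.
  apply: ler_sum => i _; rewrite mulrC ler_wpM2l//.
  by have [_ _ /andP[]] := M_bnd i wM.
- rewrite etaQE chiQE mulrA ler_pM2r ?invr_gt0// /S mulr_sumr.
  apply: ler_sum => i _; rewrite [leRHS]mulrC ler_wpM2l//.
  by have [_ _ /andP[]] := M_bnd i wM.
Qed.

Lemma cvg_etaQ_ninfty : etaq x @[x --> -oo] --> (0 : R).
Proof.
apply/cvgr0Pnorm_le => eps eps0; near=> w.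
have wM : w < - 2 * M by near: w; apply: nbhs_ninfty_lt; exact: num_real.
have wK : w < - (K / eps) by near: w; apply: nbhs_ninfty_lt; exact: num_real.
have [w1 n0 nK _ _] := bounds wM; rewrite gtr0_norm//.
have {}wK : K < eps * (- w) by rewrite [eps * _]mulrC -ltr_pdivrMr// ltrNr.
have w2 : - w <= w ^+ 2 by nra.
rewrite -(ler_pM2r (_ : 0 < w ^+ 2)); last by nra.
by apply: (le_trans nK); apply: (le_trans (ltW wK)); rewrite ler_wpM2l// ltW.
Unshelve. all: by end_near. Qed.

Lemma cvg_chiQ_ninfty : chiq x @[x --> -oo] --> e.
Proof.
apply/cvgrPdistC_le => eps eps0; near=> w.
have wM : w < - 2 * M by near: w; apply: nbhs_ninfty_lt; exact: num_real.
have wK : w < - (3 * K / eps) by near: w; apply: nbhs_ninfty_lt; exact: num_real.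
have [w1 n0 nK c1 c2] := bounds wM.
have {}wK : 3 * K < eps * (- w) by rewrite [eps * _]mulrC -ltr_pdivrMr// ltrNr.
have {}nK : 3 * (- w) * etaq w <= eps.
  rewrite -(ler_pM2r (_ : 0 < - w)); last by lra.
  by apply: le_trans (ltW wK); rewrite (_ : _ * _ = 3 * (etaq w * w ^+ 2));
    [rewrite ler_wpM2l|ring].
by rewrite ler_norml; apply/andP; split; nra.
Unshelve. all: by end_near. Qed.

Lemma tangent_directionQ_ninfty (v : R * R) : v.2 = 0 ->
  tangent_direction -oo curveQ (e, 0) v.
Proof.
move=> v20; apply: (tangent_directionI (E := fun w => chiq w - e)).
- exact: (cvg_pair cvg_chiQ_ninfty cvg_etaQ_ninfty).
- near=> w; have wM : w < - 2 * M by near: w; apply: nbhs_ninfty_lt; exact: num_real.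
  have [w1 n0 _ _ c2] := bounds wM.
  by apply/eqP => E0; nra.
- by move=> w; rewrite prod_normE/= le_max lexx.
apply/cvgr0Pnorm_le => eps eps0; near=> w.
have wM : w < - 2 * M by near: w; apply: nbhs_ninfty_lt; exact: num_real.
have wv : w < - (`|v.1| / eps) by near: w; apply: nbhs_ninfty_lt; exact: num_real.
have {}wv : `|v.1| < eps * (- w) by rewrite [eps * _]mulrC -ltr_pdivrMr// ltrNr.
have [w1 n0 _ _ c2] := bounds wM.
have E0 : chiq w - e < 0 by nra.
rewrite /cross/= v20 mulr0 subr0 sub0r normrM normrN normrM (gtr0_norm n0).
rewrite normrV ?unitfE ?lt_eqF// ler_pdivrMr ?normr_gt0 ?lt_eqF//.
by rewrite (ltr0_norm E0); nra.
Unshelve. all: by end_near. Qed.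

End Envelope.

(** * Exactly one cusp between neighbouring nodes *)

Section Cusp.
Context {R : rcfType} {I : finType}.
Variables (h d : I -> R).
Hypotheses (h_inj : injective h) (d_gt0 : forall i, 0 < d i).

Local Notation D := (nodeP h).
Local Notation V := (cuspP h d).

(** A third node lies on the same side of [h i] and [h j], so its two factors have a positive
    product. Only [(h i - h j) * (h j - h i)] is negative. *)
Let cof_sign i j : h i < h j -> (forall l, h l <= h i \/ h j <= h l) ->
  (cofP h i).[h i] * (cofP h j).[h j] < 0.
Proof.
move=> ij no; have ji : j != i by apply: contraTneq ij => ->; rewrite ltxx.
rewrite !horner_cof (bigD1 j)//= [X in _ * X](bigD1 i) 1?eq_sym//=.
rewrite [X in _ * (_ * X)](eq_bigl (fun l => (l != i) && (l != j))); last first.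
  by move=> l; rewrite andbC.
rewrite mulrACA -big_split/= nmulr_rlt0; last by nra.
apply: prodr_gt0 => l /andP[li lj].
have hli : h l != h i by apply: contraNneq li => /h_inj ->.
have hlj : h l != h j by apply: contraNneq lj => /h_inj ->.
have [] := no l; rewrite le_eqVlt.
  by rewrite (negbTE hli)/= => ?; nra.
by rewrite eq_sym (negbTE hlj)/= => ?; nra.
Qed.

Let inv_cube_lt (x y : R) : x < y -> 0 < x * y -> y^-1 ^+ 3 < x^-1 ^+ 3.
Proof.
move=> xy xy0; have [x0 y0] : x != 0 /\ y != 0.
  by split; apply: contraTneq xy0 => ->; rewrite ?mul0r ?mulr0 ltxx.
have lt1 : y^-1 < x^-1.
  rewrite -subr_gt0; have -> : x^-1 - y^-1 = (y - x) / (x * y) by field; apply/andP.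
  by rewrite divr_gt0// subr_gt0.
have : 0 < (x^-1 - y^-1) * (x^-1 ^+ 2 + x^-1 * y^-1 + y^-1 ^+ 2).
  rewrite mulr_gt0 ?subr_gt0//.
  have p2 : 0 < x^-1 ^+ 2 by rewrite exprn_even_gt0// invr_eq0.
  have := sqr_ge0 (x^-1 + y^-1); have := sqr_ge0 y^-1.
  by move: p2; set p := x^-1; set q := y^-1 => p2 q2 pq; nra.
have -> : (x^-1 - y^-1) * (x^-1 ^+ 2 + x^-1 * y^-1 + y^-1 ^+ 2) =
  x^-1 ^+ 3 - y^-1 ^+ 3 by ring.
by rewrite subr_gt0.
Qed.

(** Existence avoids the poles of [V / D ^+ 3]: the polynomial [V] itself has opposite signs at the
    two nodes. Monotonicity of the quotient serves for uniqueness only. *)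
Lemma cuspP_unique i j : h i < h j -> (forall l, h l <= h i \/ h j <= h l) ->
  exists! w, h i < w < h j /\ V.[w] = 0.
Proof.
move=> ij no.
have c0 := cof_sign ij no.
have : V.[h i] * V.[h j] < 0.
  rewrite !cusp_root//.
  have -> : d i * (cofP h i).[h i] ^+ 3 * (d j * (cofP h j).[h j] ^+ 3) =
    (d i * d j) * ((cofP h i).[h i] * (cofP h j).[h j]) ^+ 3 by ring.
  by rewrite pmulr_rlt0 ?mulr_gt0// exprn_odd_lt0.
move=> /(polyrcf.poly_ivtoo (ltW ij))[w]; rewrite in_itv/= => wij /rootP Vw.
exists w; split=> // w' [wij' Vw'].
have nroot x l : h i < x < h j -> x != h l.
  move=> /andP[x1 x2]; apply/eqP => xl; have := no l; rewrite -xl => -[]; lra.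
have D0 x : h i < x < h j -> D.[x] != 0.
  by move=> xij; apply/eqP => /nodeP_eq0[l /eqP]; apply/negP; exact: nroot.
have Vsum x : h i < x < h j ->
    V.[x] = D.[x] ^+ 3 * \sum_l d l * (x - h l)^-1 ^+ 3.
  move=> xij; rewrite horner_cusp mulr_sumr; apply: eq_bigr => l _.
  have xl : x - h l != 0 by rewrite subr_eq0 nroot.
  by rewrite (nodeP_cof h l) hornerM hornerXsubC; field.
have sum0 x : h i < x < h j -> V.[x] = 0 -> \sum_l d l * (x - h l)^-1 ^+ 3 = 0.
  move=> xij; rewrite Vsum// => /eqP; rewrite mulf_eq0 expf_eq0/=.
  by rewrite (negbTE (D0 x xij))/= => /eqP.
have mono x y : h i < x < h j -> h i < y < h j -> x < y ->
    \sum_l d l * (y - h l)^-1 ^+ 3 < \sum_l d l * (x - h l)^-1 ^+ 3.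
  move=> /andP[x1 x2] /andP[y1 y2] xy; apply: ltr_sum.
    by apply/hasP; exists i; rewrite ?mem_index_enum.
  move=> l _; rewrite ltr_pM2l//; apply: inv_cube_lt; first lra.
  by have [] := no l => ?; nra.
case: (ltgtP w w') => // lt.
  by have := mono _ _ wij wij' lt; rewrite !sum0// ltxx.
by have := mono _ _ wij' wij lt; rewrite !sum0// ltxx.
Qed.

End Cusp.

(** * Interlacing: construction of [h], [d] and [e] from [a] and [b] *)

Section Interlacing.
Context {R : rcfType}.

Lemma eq_poly_nodes {I : finType} (h : I -> R) (p q : {poly R}) :
  injective h -> (size (p - q)%R <= #|I|)%N -> (forall i, p.[h i] = q.[h i]) ->
  p = q.
Proof.
move=> h_inj spq pq; apply/eqP; rewrite -subr_eq0; apply/eqP.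
apply: (@roots_geq_poly_eq0 _ _ [seq h i | i <- enum I]).
- by apply/allP => _ /mapP[i _ ->]; rewrite /root hornerD hornerN pq subrr.
- by rewrite map_inj_uniq ?enum_uniq.
- by rewrite size_map -cardE.
Qed.

Lemma ltn_homo_inj n (c : 'I_n -> R) :
  (forall i j : 'I_n, (i < j)%N -> c i < c j) -> injective c.
Proof.
move=> c_lt i j cij; apply/val_inj; have [] := ltngtP (val i) (val j) => // /c_lt.
  by rewrite cij ltxx.
by rewrite cij ltxx.
Qed.

Lemma horner_prod_ord n (c : 'I_n -> R) w :
  (\prod_(i < n) ('X - (c i)%:P)).[w] = \prod_(i < n) (w - c i).
Proof. by rewrite horner_prod; apply: eq_bigr => i _; rewrite hornerXsubC. Qed.

Lemma horner_prod_root n (c : 'I_n -> R) i :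
  (\prod_(i < n) ('X - (c i)%:P)).[c i] = 0.
Proof. by rewrite horner_prod_ord (bigD1 i)//= subrr mul0r. Qed.

Variable m : nat.
Variables a b : 'I_m.+2 -> R.
Hypothesis lt_ab : forall i : 'I_m.+2, a i < b i.
Hypothesis lt_ba : forall i j : 'I_m.+2, j = i.+1 :> nat -> b i < a j.

Lemma interlaced_ba (i j : 'I_m.+2) : (i < j)%N -> b i < a j.
Proof.
case: j => j jm /=; elim: j jm => // j IH jm.
rewrite ltnS leq_eqVlt => /orP[/eqP ij|ij]; first by apply: lt_ba; rewrite /= ij.
have jm' : (j < m.+2)%N by exact: ltnW.
apply: (lt_trans (IH jm' ij)); apply: (lt_trans (lt_ab _)).
exact: lt_ba.
Qed.

Lemma interlaced_ab (i j : 'I_m.+2) : (i <= j)%N -> a i < b j.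
Proof.
rewrite leq_eqVlt => /orP[/eqP/val_inj ->|ij]; first exact: lt_ab.
exact: (lt_trans (lt_ab i) (lt_trans (interlaced_ba ij) (lt_ab j))).
Qed.

Lemma interlaced_aa (i j : 'I_m.+2) : (i <= j)%N -> a i <= a j.
Proof.
rewrite leq_eqVlt => /orP[/eqP/val_inj ->//|ij].
exact: ltW (lt_trans (lt_ab i) (interlaced_ba ij)).
Qed.

Lemma interlaced_bb (i j : 'I_m.+2) : (i <= j)%N -> b i <= b j.
Proof.
rewrite leq_eqVlt => /orP[/eqP/val_inj ->//|ij].
exact: ltW (lt_trans (interlaced_ba ij) (lt_ab j)).
Qed.

Local Notation A := (\prod_(i < m.+2) ('X - (a i)%:P)).
Local Notation B := (\prod_(i < m.+2) ('X - (b i)%:P)).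

Let wd (j : 'I_m.+1) : 'I_m.+2 := widen_ord (leqnSn m.+1) j.
Let lf (j : 'I_m.+1) : 'I_m.+2 := lift ord0 j.

Let gap_root j : {x | b (wd j) < x < a (lf j) & root (A - B) x}.
Proof.
have ba : b (wd j) < a (lf j) by exact: lt_ba.
have [|x] := @polyrcf.poly_ivtoo _ (A - B) _ _ (ltW ba); last first.
  by rewrite in_itv/=; exists x.
rewrite !hornerD !hornerN !horner_prod_root subr0 sub0r mulrN oppr_lt0.
(* At the ends of the gap [A - B] takes the values [A] and [- B]. In the product of [A] and [B] the
   two factors of index [i] have the same sign: positive for [i <= j], negative for later [i]. *)
rewrite !horner_prod_ord -big_split/=; apply: prodr_gt0 => i _.
have [ij|ij] := leqP i j.
  apply: mulr_gt0; rewrite subr_gt0; first exact: interlaced_ab.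
  exact: interlaced_ba.
rewrite -mulrNN !opprB; apply: mulr_gt0; rewrite subr_gt0; first exact: interlaced_ba.
exact: interlaced_ab.
Qed.

Let h j : R := s2val (gap_root j).

Let h_itv j : b (wd j) < h j < a (lf j).
Proof. by rewrite /h; case: gap_root. Qed.

Let h_root j : (A - B).[h j] = 0.
Proof. by rewrite /h; case: gap_root => /= x _ /rootP. Qed.

Let h_lt (i j : 'I_m.+1) : (i < j)%N -> h i < h j.
Proof.
move=> ij; have /andP[_ h1] := h_itv i; have /andP[h2 _] := h_itv j.
apply: (lt_trans h1 (lt_trans _ h2)); exact: interlaced_ab.
Qed.

Let h_inj : injective h.
Proof. exact: ltn_homo_inj. Qed.

Let size_index_ord n : size (index_enum 'I_n) = n.
Proof. by rewrite [index_enum _]unlock -enumT size_enum_ord. Qed.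

Let coefA (c : 'I_m.+2 -> R) : (\prod_(i < m.+2) ('X - (c i)%:P))`_m.+1 = - \sum_i c i.
Proof.
have := @coefPn_prod_XsubC R (map c (index_enum 'I_m.+2)).
by rewrite size_map size_index_ord !big_map => /(_ isT).
Qed.

Let sizeA (c : 'I_m.+2 -> R) : size (\prod_(i < m.+2) ('X - (c i)%:P)) = m.+3.
Proof. by rewrite size_prod_XsubC size_index_ord. Qed.

Let coefAn (c : 'I_m.+2 -> R) : (\prod_(i < m.+2) ('X - (c i)%:P))`_m.+2 = 1.
Proof.
have := monicP (monic_prod_XsubC (index_enum 'I_m.+2) xpredT c).
by rewrite lead_coefE sizeA.
Qed.

Let size_polyB (p q : {poly R}) : (size (p - q)%R <= maxn (size p) (size q))%N.
Proof. by rewrite -(size_polyN q); exact: size_polyD. Qed.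

Let size_sub_coef (p : {poly R}) n : (size p <= n.+1)%N -> p`_n = 0 ->
  (size p <= n)%N.
Proof.
move=> /leq_sizeP sp pn; apply/leq_sizeP => i; rewrite leq_eqVlt => /orP[/eqP <-//|].
exact: sp.
Qed.

Hypothesis sum_ab : \sum_(i < m.+2) (b i - a i) = 1.

Let size_D : (size (A - B)%R <= m.+2)%N.
Proof.
apply: size_sub_coef; last by rewrite coefB !coefAn subrr.
by rewrite (leq_trans (size_polyB _ _))// !sizeA maxnn.
Qed.

(** The leading terms of [A] and [B] cancel, and the next coefficient is the total length of the
    intervals. *)
Let coef_D : (A - B)`_m.+1 = 1.
Proof. by rewrite coefB !coefA opprK addrC -sumrB. Qed.

Let size_node : size (nodeP h) = m.+2.
Proof. by rewrite /nodeP size_prod_XsubC size_index_ord. Qed.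

Let coef_node : (nodeP h)`_m.+1 = 1.
Proof.
have := monicP (monic_prod_XsubC (index_enum 'I_m.+1) xpredT h).
by rewrite lead_coefE -/(nodeP h) size_node.
Qed.

Let node_AB : A - B = nodeP h.
Proof.
apply: (eq_poly_nodes h_inj) => [|i]; last by rewrite h_root root_nodeP.
rewrite card_ord; apply: size_sub_coef; last by rewrite coefB coef_D coef_node subrr.
by rewrite (leq_trans (size_polyB _ _))// geq_max size_D size_node leqnn.
Qed.

Let size_cof j : size (cofP h j) = m.+1.
Proof.
have := size_node; rewrite (nodeP_cof h j) size_mul ?polyXsubC_eq0//.
  by rewrite size_XsubC/= => -[].
by apply/prodf_neq0 => i _; rewrite polyXsubC_eq0.
Qed.

Let B_cof_lt0 j : B.[h j] * (cofP h j).[h j] < 0.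
Proof.
have /andP[h1 h2] := h_itv j.
(* [B] has two factors more than [cofP h j]. The factor of [b ord0] is positive and that of
   [b (lift ord0 j)] negative; each other [b (lift ord0 l)] is paired with [h l], on the same side
   of [h j]. *)
rewrite horner_prod_ord horner_cof big_ord_recl (bigD1 j)//=.
rewrite -mulrA -mulrA -big_split/=.
rewrite pmulr_rlt0; last first.
  by rewrite subr_gt0; apply: le_lt_trans h1; exact: interlaced_bb.
rewrite nmulr_rlt0; last first.
  by rewrite subr_lt0; apply: lt_trans h2 (lt_ab _).
apply: prodr_gt0 => l; rewrite neq_ltn => /orP[lj|lj].
  apply: mulr_gt0; rewrite subr_gt0; last exact: h_lt.
  by apply: le_lt_trans h1; exact: interlaced_bb.
rewrite -mulrNN !opprB; apply: mulr_gt0; rewrite subr_gt0; last exact: h_lt.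
by apply: lt_trans h2 _; apply: interlaced_ab; exact: ltnW.
Qed.

Lemma interlacing_partial_fractions :
  exists (h d : 'I_m.+1 -> R) (e : R),
  [/\ forall j, b (widen_ord (leqnSn m.+1) j) < h j < a (lift ord0 j),
      forall i j : 'I_m.+1, (i < j)%N -> h i < h j,
      forall j, 0 < d j, A - B = nodeP h & B = numP h d e].
Proof.
(* [- d j] is the residue of [B / D] at [h j], and [e] cancels the coefficient of degree [m.+1] in
   [B - ('X - e) * D]. The two sides then differ by a polynomial of degree at most [m] vanishing at
   [m.+1] nodes. *)
pose d j := - (B.[h j] / (cofP h j).[h j]).
pose e := - (B - 'X * nodeP h)`_m.+1.
exists h, d, e; split => // [j|].
  have := B_cof_lt0 j; have c0 := cof_root_neq0 h_inj j.
  have -> : d j = - (B.[h j] * (cofP h j).[h j]) / (cofP h j).[h j] ^+ 2.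
    by rewrite /d; field.
  by rewrite -oppr_gt0 => ?; rewrite divr_gt0// exprn_even_gt0.
apply: (eq_poly_nodes h_inj) => [|j]; last first.
  rewrite num_root// /d mulNr opprK divfK//.
  exact: cof_root_neq0.
rewrite card_ord.
have -> : B - numP h d e =
   (B - 'X * nodeP h + e *: nodeP h) + \sum_i d i *: cofP h i.
  by rewrite /numP -mul_polyC; ring.
rewrite (leq_trans (size_polyD _ _))// geq_max; apply/andP; split; last first.
  apply/leq_sizeP => i im; rewrite coef_sum big1// => j _.
  by rewrite coefZ nth_default ?mulr0// size_cof.
have sXD : size ('X * nodeP h) = m.+3.
  by rewrite mulrC size_mulX ?size_node// -size_poly_eq0 size_node.
apply: size_sub_coef; last first.
  by rewrite coefD coefZ coef_node mulr1 /e subrr.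
rewrite (leq_trans (size_polyD _ _))// geq_max; apply/andP; split; last first.
  by rewrite (leq_trans (size_scale_leq _ _))// size_node.
apply: size_sub_coef; last by rewrite coefB coefAn mulrC coefMX/= coef_node subrr.
by rewrite (leq_trans (size_polyB _ _))// sizeA sXD maxnn.
Qed.

End Interlacing.

(** * The sides belong to the boundary of the polygon *)

Section Polygon.
Context {R : realType}.
Implicit Types (z c : R * R) (U : set (R * R)) (s : (R * R) * (R * R)).

Definition halfplane (l : R * R * R) z : R := l.1.1 * z.1 + l.1.2 * z.2 + l.2.

Lemma closure_ray U z c :
  (forall t, 0 < t <= 1 -> U ((1 - t) * z.1 + t * c.1, (1 - t) * z.2 + t * c.2)) ->
  closure U z.
Proof.
move=> Ut N Nz.
pose g (t : R) : R * R := ((1 - t) * z.1 + t * c.1, (1 - t) * z.2 + t * c.2).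
have gz : g t @[t --> (0 : R)^'+] --> z.
  apply: cvg_at_right_filter; rewrite [X in _ --> X]surjective_pairing.
  have coord (x y : R) : (1 - t) * x + t * y @[t --> (0 : R)] --> x.
    have : (((y - x)%:P * 'X + x%:P).[t] : R) @[t --> (0 : R)] -->
        ((y - x)%:P * 'X + x%:P).[0] by exact: continuous_horner.
    rewrite !hornerE ?mulr0 ?add0r; apply: cvg_trans; apply: near_eq_cvg.
    by near=> t; rewrite !hornerE; ring.
  exact: (cvg_pair (coord _ _) (coord _ _)).
near (0 : R)^'+ => t; exists (g t); split; last by near: t; exact: gz.
by apply: Ut; apply/andP; split; near: t;
  [exact: nbhs_right_gt|exact: nbhs_right_le].
Unshelve. all: by end_near. Qed.

(** Weak inequalities at the endpoints and strict ones at [c] make every [l] strictly positive on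
    the way from the segment to [c], so the segment is a limit of points of [U]. *)
Lemma closure_segment U (L : seq (R * R * R)) c s :
  (forall z, all (fun l => 0 < halfplane l z) L -> U z) ->
  all (fun l => 0 < halfplane l c) L ->
  all (fun l => (0 <= halfplane l s.1) && (0 <= halfplane l s.2)) L ->
  segment s `<=` closure U.
Proof.
move=> LU /allP Lc /allP Ls _ [t /andP[t0 t1] ->]; apply: (@closure_ray _ _ c).
move=> u /andP[u0 u1]; apply: LU; apply/allP => l lL.
have c0 := Lc l lL; have /andP[s1 s2] := Ls l lL.
rewrite (_ : halfplane l _ = (1 - u) * ((1 - t) * halfplane l s.1 +
  t * halfplane l s.2) + u * halfplane l c); last by rewrite /halfplane/=; ring.
rewrite ltr_wpDl ?mulr_gt0//.
by rewrite mulr_ge0 ?subr_ge0// addr_ge0// mulr_ge0// subr_ge0.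
Qed.

Lemma boundary_segmentI U s : s.1 <> s.2 -> segment s `<=` closure U ->
  (forall z, segment s z -> ~ U z) -> boundary_segment U s.
Proof.
by move=> s12 sU nU; split=> // z sz; split; [exact: sU|move=> /interior_subset; exact: nU].
Qed.

Variable m : nat.
Variables a b : 'I_m.+2 -> R.
Hypothesis lt_ab : forall i : 'I_m.+2, a i < b i.
Hypothesis lt_ba : forall i j : 'I_m.+2, j = i.+1 :> nat -> b i < a j.
Hypothesis sum_ab : \sum_(i < m.+2) (b i - a i) = 1.

Local Notation U := (polygon_interior a b).
Local Notation a0 := (a ord0).
Local Notation bm := (b ord_max).

Lemma gap_lt1 i : b i - a i < 1.
Proof.
have [j ji] : exists j : 'I_m.+2, j != i.
  by have [->|i0] := eqVneq i ord0; [exists ord_max|exists ord0; rewrite eq_sym].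
rewrite -sum_ab (bigD1 i)//= ltrDl (bigD1 j)//=.
by apply: ltr_wpDr; [apply: sumr_ge0 => l _; rewrite subr_ge0 ltW|rewrite subr_gt0].
Qed.

Lemma sum_gaps_le n (c d : 'I_n.+1 -> R) :
  (forall i j : 'I_n.+1, j = i.+1 :> nat -> d i < c j) ->
  \sum_(i < n.+1) (d i - c i) <= d ord_max - c ord0.
Proof.
elim: n c d => [|n IH] c d cd; first by rewrite big_ord1 [ord_max]ord1.
rewrite big_ord_recr/=.
have /= := IH (c \o widen_ord (leqnSn _)) (d \o widen_ord (leqnSn _)).
move=> /(_ (fun i j ij => cd (widen_ord _ i) (widen_ord _ j) ij)) le1.
have lt1 : d (widen_ord (leqnSn n.+1) ord_max) < c ord_max by exact: cd.
have E : widen_ord (leqnSn n.+1) ord0 = ord0 by exact: val_inj.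
by rewrite E in le1; apply: (le_trans (lerD le1 (lexx _))); lra.
Qed.

Lemma a0_lt_bm : a0 + 1 < bm.
Proof.
have := sum_ab; rewrite big_ord_recr/=.
have /= := @sum_gaps_le m (a \o widen_ord (leqnSn _)) (b \o widen_ord (leqnSn _)).
move=> /(_ (fun i j ij => @lt_ba (widen_ord _ i) (widen_ord _ j) ij)).
have lt1 : b (widen_ord (leqnSn m.+1) ord_max) < a ord_max by exact: lt_ba.
have E : widen_ord (leqnSn m.+1) ord0 = ord0 by exact: val_inj.
rewrite E; lra.
Qed.

Let aa := interlaced_aa lt_ab lt_ba.
Let bb := interlaced_bb lt_ab lt_ba.

(* Half-planes cutting out a convex part of the polygon that touches every side
   between b_i and a_j, for consecutive i and j. *)
Let strip (j : 'I_m.+2) (i : 'I_m.+2) : seq (R * R * R) :=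
  [:: (1, 0, - b i); (-1, -1, a j + 1); (1, 1, - (a0 + 1)); (-1, 0, bm);
      (0, 1, 0); (0, -1, 1)].

Let stripE j i z : all (fun l => 0 < halfplane l z) (strip j i) =
  [&& b i < z.1, z.1 + z.2 < a j + 1, a0 + 1 < z.1 + z.2, z.1 < bm, 0 < z.2 & z.2 < 1].
Proof.
rewrite /strip/= /halfplane/= andbT.
by congr [&& _, _, _, _, _ & _]; apply/idP/idP => ?; lra.
Qed.

Let strip_sub (i j : 'I_m.+2) z : j = i.+1 :> nat ->
  all (fun l => 0 < halfplane l z) (strip j i) -> U z.
Proof.
rewrite stripE => ij /and5P[z1 z2 z3 z4 /andP[z5 z6]]; split=> [|l l0|l lm|l].
- by rewrite z5.
- have -> : l = ord0 by exact: val_inj.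
  by lra.
- have -> : l = ord_max by apply: val_inj => /=; case: lm.
  by [].
- move=> /andP[l1 l2]; have [li|li] := leqP l i.
    by have := bb li; lra.
  by have := @aa j l; rewrite ij => /(_ li); lra.
Qed.

Let strip_closure (i j : 'I_m.+2) s : j = i.+1 :> nat ->
  all (fun l => (0 <= halfplane l s.1) && (0 <= halfplane l s.2)) (strip j i) ->
  segment s `<=` closure U.
Proof.
move=> ij.
(* The witness lies below the midpoint of the top side, at a depth in [(0, 1)] that keeps it above
   the line [chi + eta = a0 + 1]. *)
apply: (closure_segment (c := ((b i + a j) / 2, 1 - (b i - a i) / 2))).
  by move=> z; exact: strip_sub.
rewrite stripE/=; have := lt_ab i; have := lt_ba ij; have := gap_lt1 i.
have := @aa ord0 i (leq0n _); have := lt_ab j.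
have := @bb j ord_max; rewrite -ltnS ltn_ord => /(_ isT).
by move=> *; apply/and5P; split; [..|apply/andP; split]; lra.
Qed.

Let stripLE j i s :
  all (fun l => (0 <= halfplane l s.1) && (0 <= halfplane l s.2)) (strip j i) =
  [&& b i <= s.1.1, s.1.1 + s.1.2 <= a j + 1, a0 + 1 <= s.1.1 + s.1.2, s.1.1 <= bm,
    0 <= s.1.2 & s.1.2 <= 1] &&
  [&& b i <= s.2.1, s.2.1 + s.2.2 <= a j + 1, a0 + 1 <= s.2.1 + s.2.2, s.2.1 <= bm,
    0 <= s.2.2 & s.2.2 <= 1].
Proof.
rewrite /strip/= /halfplane/= andbT.
apply/idP/idP.
  by move=> /and5P[/andP[? ?] /andP[? ?] /andP[? ?] /andP[? ?] /andP[/andP[? ?] /andP[? ?]]];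
    apply/andP; split; apply/and5P; split; [..|apply/andP; split]; lra.
move=> /andP[/and5P[? ? ? ? /andP[? ?]] /and5P[? ? ? ? /andP[? ?]]].
by apply/and5P; split; [..|apply/andP; split]; apply/andP; split; lra.
Qed.

Let pred_ord (j : 'I_m.+2) : (0 < j)%N -> exists i : 'I_m.+2, j = i.+1 :> nat.
Proof.
case: j => [[//|j] jm] _.
by exists (Ordinal (ltnW jm : (j < m.+2)%N)).
Qed.

Let succ_ord (i : 'I_m.+2) : (i.+1 < m.+2)%N -> exists j : 'I_m.+2, j = i.+1 :> nat.
Proof. by move=> im; exists (Ordinal im). Qed.

Lemma boundary_diagonal i : boundary_segment U (diagonal_side a b i).
Proof.
have i_ab := lt_ab i; have i1 := gap_lt1 i; have abm := a0_lt_bm.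
have i0 : a0 <= a i by exact: aa.
have im : b i <= bm by apply: bb; rewrite -ltnS.
apply: boundary_segmentI; rewrite /diagonal_side.
- by case: ifP => _ /= [] ? ?; lra.
(* The first diagonal side bounds the strip on its right, every other one the strip on its left. *)
- case: ifP => [/eqP i00|/negbT in0].
    have [j ji] : exists j : 'I_m.+2, j = i.+1 :> nat by apply: succ_ord; rewrite i00.
    have E : i = ord0 by exact: val_inj.
    apply: (strip_closure ji); rewrite stripLE/=.
    have := @aa i j; rewrite ji leqnSn => /(_ isT) => ?; rewrite -E in i0 abm *.
    by do ![apply/andP; split]; lra.
  have [j ij] : exists j : 'I_m.+2, i = j.+1 :> nat by apply: pred_ord; rewrite lt0n.
  have ji := lt_ba ij; have j1 := lt_ab j; have j0 : a0 <= a j by exact: aa.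
  apply: (strip_closure ij); rewrite stripLE/=.
  by do ![apply/andP; split]; lra.
- move=> _ [t /andP[t0 t1] ->] [_ /(_ ord0 erefl)/= H0 _ /(_ i) Hi]; move: H0 Hi.
  case: ifP => [/eqP i00|_]/=.
    have -> : i = ord0 by exact: val_inj.
    nra.
  move=> _; apply; apply/andP; split; nra.
Qed.

Lemma boundary_vertical i : boundary_segment U (vertical_side a b i).
Proof.
have i_ab := lt_ab i; have i1 := gap_lt1 i; have abm := a0_lt_bm.
have i0 : a0 <= a i by exact: aa.
have im : b i <= bm by apply: bb; rewrite -ltnS.
apply: boundary_segmentI; rewrite /vertical_side.
- by case: ifP => _ /= [] ?; lra.
- case: ifP => [/eqP ik|/negbT in0].
    have E : i = ord_max by apply: val_inj => /=; case: ik.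
    have [j ij] : exists j : 'I_m.+2, i = j.+1 :> nat by apply: pred_ord; rewrite E.
    have ji := lt_ba ij; have j1 := lt_ab j; have j0 : a0 <= a j by exact: aa.
    apply: (strip_closure ij); rewrite stripLE/=; rewrite -E in im abm *.
    by do ![apply/andP; split]; lra.
  have [j ji] : exists j : 'I_m.+2, j = i.+1 :> nat.
    by apply: succ_ord; rewrite ltn_neqAle in0/=.
  have ij := lt_ba ji.
  apply: (strip_closure ji); rewrite stripLE/=.
  by do ![apply/andP; split]; lra.
- move=> _ [t /andP[t0 t1] ->] [_ _ /(_ i)/= Hm /(_ i)/= Hi]; move: Hm Hi.
  case: ifP => [/eqP ik /(_ ik)|_ _]/=; first by move=> ? _; lra.
  by apply; apply/andP; split; nra.
Qed.

Lemma boundary_top (i j : 'I_m.+2) : j = i.+1 :> nat ->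
  boundary_segment U (top_side a b i j).
Proof.
move=> ji; have ij := lt_ba ji; have i_ab := lt_ab i; have j_ab := lt_ab j.
have i0 : a0 <= a i by exact: aa.
have jm : b j <= bm by apply: bb; rewrite -ltnS.
apply: boundary_segmentI; rewrite /top_side.
- by move=> [] /eqP; rewrite lt_eqF.
- apply: (strip_closure ji); rewrite stripLE/=.
  by do ![apply/andP; split]; lra.
- by move=> _ [t /andP[t0 t1] ->] [/andP[/= _ +] _ _ _]; rewrite !mulr1 subrK ltxx.
Qed.

Lemma boundary_bottom (i j : 'I_m.+2) : i = 0%N :> nat -> j.+1 = m.+2 ->
  boundary_segment U (bottom_side a b i j).
Proof.
move=> i0 jm; have -> : i = ord0 by exact: val_inj.
have -> : j = ord_max by apply: val_inj => /=; case: jm.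
have abm := a0_lt_bm.
apply: boundary_segmentI; rewrite /bottom_side.
- by move=> [] /eqP; rewrite lt_eqF.
(* No strip contains the bottom side. Instead, every removed triangle stays at height at least [g],
   and below [g] the polygon is convex. *)
- have [g g1] : exists g, 0 < g /\ forall l, g <= 1 - (b l - a l).
    pose l0 := [arg min_(l < ord0 : 'I_m.+2) (1 - (b l - a l))]%O.
    exists (1 - (b l0 - a l0)); split; first by have := gap_lt1 l0; lra.
    by move=> l; rewrite /l0; case: arg_minP => //= l1 _; exact.
  have [g0 {}g1] := g1; have g11 : g < 1 by have := g1 ord0; have := lt_ab ord0; lra.
  apply: (@closure_segment _ [:: (1, 1, - (a0 + 1)); (-1, 0, bm); (0, 1, 0); (0, -1, g)]
    ((a0 + 1 + bm) / 2, g / 2)); rewrite /halfplane/=.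
  + move=> z /and5P[z1 z2 z3 z4 _]; split.
    * by apply/andP; split; lra.
    * by move=> l l0; have -> : l = ord0 by [exact: val_inj]; lra.
    * move=> l lm; have -> : l = ord_max by apply: val_inj => /=; case: lm.
      by lra.
    * by move=> l /andP[? ?]; have := g1 l; lra.
  + by apply/and5P; split => //; lra.
  + by apply/and5P; split => //; apply/andP; split; lra.
- by move=> _ [t /andP[t0 t1] ->] [/andP[/= + _] _ _ _]; rewrite !mulr0 addr0 ltxx.
Qed.

End Polygon.

(** * Transfer to [chi], [eta], [Omega], and the points of contact *)

Section FrozenBoundaryCurve.
Context {R : realType}.

Lemma horner_deriv_prod_XsubC {J : Type} (r : seq J) (c : J -> R) w :
  (forall i, w - c i != 0) ->
  (\prod_(i <- r) ('X - (c i)%:P))^`().[w] =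
  (\prod_(i <- r) ('X - (c i)%:P)).[w] * \sum_(i <- r) (w - c i)^-1.
Proof.
move=> c0; elim: r => [|i r IH]; first by rewrite !big_nil derivC horner0 mulr0.
rewrite !big_cons derivM derivXsubC mul1r hornerD !hornerM IH hornerXsubC.
by move: (c0 i) => ?; field.
Qed.

Variable m : nat.
Variables a b : 'I_m.+2 -> R.
Hypothesis lt_ab : forall i : 'I_m.+2, a i < b i.
Hypothesis lt_ba : forall i j : 'I_m.+2, j = i.+1 :> nat -> b i < a j.
Variables (h d : 'I_m.+1 -> R) (e : R).

Local Notation A := (\prod_(i < m.+2) ('X - (a i)%:P)).
Local Notation Bab := (\prod_(i < m.+2) ('X - (b i)%:P)).
Local Notation D := (nodeP h).
Local Notation B := (numP h d e).
Local Notation W := (wronP h d).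
Local Notation V := (cuspP h d).

Hypothesis h_itv : forall j, b (widen_ord (leqnSn m.+1) j) < h j < a (lift ord0 j).
Hypothesis h_lt : forall i j : 'I_m.+1, (i < j)%N -> h i < h j.
Hypothesis d_gt0 : forall j, 0 < d j.
Hypothesis AB : A - Bab = D.
Hypothesis BE : Bab = B.

Lemma nodes_inj : injective h.
Proof. exact: ltn_homo_inj. Qed.

Let Wn0 w : W.[w] != 0.
Proof. by rewrite gt_eqF// wron_gt0//; exact: nodes_inj. Qed.

Let AE : A = D + B. Proof. by rewrite -AB -BE subrK. Qed.

Let horner_A w : A.[w] = D.[w] + B.[w].
Proof. by rewrite AE hornerD. Qed.

Lemma PiE w : Pi a b w = B.[w] / (D.[w] + B.[w]).
Proof. by rewrite -horner_A -BE !horner_prod_ord /Pi big_split/= prodfV. Qed.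

Lemma horner_b i : B.[b i] = 0.
Proof. by rewrite -BE horner_prod_root. Qed.

Lemma horner_a i : B.[a i] = - D.[a i].
Proof. by apply/eqP; rewrite -addr_eq0 addrC -horner_A horner_prod_root. Qed.

Lemma node_neq0 w : D.[w] = 0 -> B.[w] != 0.
Proof.
move=> /nodeP_eq0[i ->]; rewrite num_root.
rewrite oppr_eq0; apply: mulf_neq0; last exact: cof_root_neq0 nodes_inj _.
by rewrite gt_eqF.
Qed.

Lemma horner_b_neq0 i : D.[b i] != 0.
Proof. by apply: contra_eq_neq (horner_b i) => /node_neq0. Qed.

Lemma horner_a_neq0 i : D.[a i] != 0.
Proof.
apply/eqP => Da; have := node_neq0 Da.
by rewrite horner_a Da oppr0 eqxx.
Qed.

Let special w := [exists i, (w == a i) || (w == b i)].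

Let nonspecial w : ~~ special w -> D.[w] + B.[w] != 0 /\ B.[w] != 0.
Proof.
move=> /existsPn sw; rewrite -horner_A -BE !horner_prod_ord.
by split; apply/prodf_neq0 => i _; rewrite subr_eq0;
  have := sw i; rewrite negb_or => /andP[].
Qed.

Let A_neq0 : A != 0. Proof. exact/monic_neq0/monic_prod_XsubC. Qed.
Let B_neq0 : B != 0. Proof. rewrite -BE; exact/monic_neq0/monic_prod_XsubC. Qed.
Let D_neq0 : D != 0. Proof. exact: nodeP_neq0. Qed.

Let near_A w : \forall x \near w^', D.[x] + B.[x] != 0.
Proof. by near=> x; rewrite -horner_A; near: x; exact: horner_near_neq0.
Unshelve. all: by end_near. Qed.

Let near_B w : \forall x \near w^', B.[x] != 0.
Proof. exact: horner_near_neq0. Qed.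

Let near_nonspecial w : \forall x \near w^', ~~ special x.
Proof.
near=> x; apply/existsPn => i; rewrite negb_or; apply/andP; split.
  apply/eqP => xa; have : D.[x] + B.[x] != 0 by near: x; exact: near_A.
  by rewrite -horner_A xa horner_prod_root eqxx.
apply/eqP => xb; have : B.[x] != 0 by near: x; exact: near_B.
by rewrite xb horner_b eqxx.
Unshelve. all: by end_near. Qed.

(** It suffices that [f] agrees near [w] with a function continuous at [w]: this turns the values
    prescribed as limits into ordinary values. *)
Let extendE (f g : R -> R) w :
  (\forall x \near w^', f x = g x) -> (~~ special w -> f w = g w) ->
  {for w, continuous g} -> extend a b f w = g w.
Proof.
move=> fg fgw gw; rewrite /extend -/(special w); case: ifPn => [_|/fgw//].
apply/cvg_lim => //.
have : g x @[x --> w^'] --> g w by apply: cvg_within_filter; exact: gw.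
by apply: cvg_trans; apply: near_eq_cvg; apply: filterS fg => x ->.
Qed.

(** [Sigma] is the logarithmic derivative of [B / A], and replacing [A] by [D + B] leaves the
    Wronskian of [B] and [D] in the numerator. *)
Let SigmaE w : ~~ special w -> Sigma a b w = W.[w] / ((D.[w] + B.[w]) * B.[w]).
Proof.
move=> sw; have [A0 B0] := nonspecial sw.
have na i : w - a i != 0.
  by move/existsPn: sw => /(_ i); rewrite negb_or subr_eq0 => /andP[].
have nb i : w - b i != 0.
  by move/existsPn: sw => /(_ i); rewrite negb_or subr_eq0 => /andP[].
rewrite (horner_wronE h d e) /Sigma sumrB.
have := horner_deriv_prod_XsubC (index_enum 'I_m.+2) nb; rewrite BE.
have := horner_deriv_prod_XsubC (index_enum 'I_m.+2) na.
rewrite AE derivD (hornerD D^`() B^`()) (hornerD D B).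
set sa := \sum_i (w - a i)^-1; set sb := \sum_i (w - b i)^-1 => Ea Eb.
have -> : D^`().[w] = (D.[w] + B.[w]) * sa - B.[w] * sb by rewrite -Ea -Eb; ring.
by rewrite Eb; field; rewrite B0 A0.
Qed.

Lemma chiE : chi a b = chiQ h d e.
Proof.
apply/funext => w; have H x : ~~ special x ->
    x + (Pi a b x - 1) / Sigma a b x = chiQ h d e x.
  move=> sx; have [A0 B0] := nonspecial sx.
  by rewrite PiE SigmaE// /chiQ; field; rewrite A0 B0 Wn0.
apply: extendE; [by apply: filterS (near_nonspecial w)|exact: H|].
exact: (continuous_chiQ nodes_inj d_gt0).
Qed.

Lemma etaE : eta a b = etaQ h d.
Proof.
apply/funext => w; have H x : ~~ special x ->
    (Pi a b x * (Sigma a b x - Pi a b x + 2) - 1) / (Pi a b x * Sigma a b x) =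
    etaQ h d x.
  move=> sx; have [A0 B0] := nonspecial sx.
  by rewrite PiE SigmaE// /etaQ; field; rewrite A0 B0 Wn0.
apply: extendE; [by apply: filterS (near_nonspecial w)|exact: H|].
exact: (continuous_etaQ nodes_inj d_gt0).
Qed.

Lemma curveE : curve a b = curveQ h d e.
Proof. by rewrite /curve chiE etaE. Qed.

Lemma slopeTE w : D.[w] != 0 -> slopeT a b w = B.[w] / D.[w].
Proof.
move=> D0; have H x : ~~ special x -> D.[x] != 0 ->
    Pi a b x / (1 - Pi a b x) = B.[x] / D.[x].
  by move=> /nonspecial[A0 B0] Dx; rewrite PiE; field; rewrite A0 Dx.
apply: (@extendE _ (fun x => B.[x] / D.[x])).
- near=> x; apply: H; near: x; first exact: near_nonspecial.
  exact: horner_near_neq0.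
- by move=> sw; exact: H.
- exact: cvg_horner_div.
Unshelve. all: by end_near. Qed.

Lemma Pi_eq1 w : Pi a b w = 1 <-> D.[w] = 0.
Proof.
rewrite PiE; split=> [E|D0]; last by rewrite D0 add0r divff// node_neq0.
(* At a zero of [A] the division convention gives [Pi] the value 0, not 1. *)
have A0 : D.[w] + B.[w] != 0.
  by apply: contra_eq_neq E => ->; rewrite invr0 mulr0 eq_sym oner_eq0.
by apply: (addIr B.[w]); rewrite add0r -(divr1_eq E).
Qed.

Lemma OmegaE w : D.[w] != 0 -> D.[w] + B.[w] != 0 ->
  Omega a b w = B.[w] / (D.[w] + B.[w]).
Proof.
move=> D0 A0; rewrite /Omega chiE etaE.
have -> : w - chiQ h d e w = B.[w] * D.[w] / W.[w] by rewrite /chiQ; ring.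
have -> : B.[w] * D.[w] / W.[w] + 1 - etaQ h d w = (D.[w] + B.[w]) * D.[w] / W.[w].
  by rewrite /etaQ; field.
by field; rewrite D0 A0 Wn0.
Qed.

Lemma near_OmegaE w : \forall x \near w^', Omega a b x = B.[x] / (D.[x] + B.[x]).
Proof.
by near=> x; apply: OmegaE; near: x; [exact: horner_near_neq0|exact: near_A].
Unshelve. all: by end_near. Qed.

Let cvg_Omega w : D.[w] + B.[w] != 0 ->
  Omega a b x @[x --> w^'] --> B.[w] / (D.[w] + B.[w]).
Proof.
move=> A0; have : B.[x] / (D + B).[x] @[x --> w^'] --> B.[w] / (D + B).[w].
  by apply: cvg_within_filter; apply: cvg_horner_div; rewrite hornerD.
rewrite hornerD; apply: cvg_trans; apply: near_eq_cvg.
by apply: filterS (near_OmegaE w) => x ->; rewrite hornerD.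
Qed.

Lemma cvg_Omega_b i : Omega a b w @[w --> (b i)^'] --> (0 : R).
Proof.
have := @cvg_Omega (b i); rewrite horner_b addr0 mul0r; apply.
exact: horner_b_neq0.
Qed.

Lemma cvg_Omega_h j : Omega a b w @[w --> (h j)^'] --> (1 : R).
Proof.
have B0 := node_neq0 (root_nodeP h j).
by have := @cvg_Omega (h j); rewrite root_nodeP add0r divff//; exact.
Qed.

Lemma cvg_Omega_a i : `|Omega a b w| @[w --> (a i)^'] --> +oo.
Proof.
apply/gtr0_cvgV0.
  near=> x; rewrite normr_gt0.
  have -> : Omega a b x = B.[x] / (D.[x] + B.[x]) by near: x; exact: near_OmegaE.
  by rewrite mulf_neq0 ?invr_eq0//; near: x; [exact: near_B|exact: near_A].
have B0 : B.[a i] != 0 by rewrite horner_a oppr_eq0 horner_a_neq0.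
have : `|(D + B).[x] / B.[x]| @[x --> (a i)^'] --> `|(D + B).[a i] / B.[a i]|.
  by apply: cvg_norm; apply: cvg_within_filter; exact: cvg_horner_div.
rewrite hornerD horner_a subrr mul0r normr0.
apply: cvg_trans; apply: near_eq_cvg.
apply: filterS (near_OmegaE (a i)) => x Ox; rewrite /= Ox.
by rewrite (hornerD D B) -normfV invf_div.
Unshelve. all: by end_near. Qed.

(** Multiplying by [A = D + B] removes the poles of [Omega]: in the limit [B.[w] = A.[w]], that is
    [D.[w] = 0]. *)
Lemma Omega_cvg1 w : Omega a b x @[x --> w^'] --> (1 : R) -> exists j, w = h j.
Proof.
move=> O1; apply: nodeP_eq0.
have cA : (D + B).[x] @[x --> w^'] --> (D + B).[w].
  by apply: cvg_within_filter; exact: continuous_horner.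
have cB : B.[x] @[x --> w^'] --> B.[w].
  by apply: cvg_within_filter; exact: continuous_horner.
have : B.[x] @[x --> w^'] --> 1 * (D + B).[w].
  have : Omega a b x * (D + B).[x] @[x --> w^'] --> 1 * (D + B).[w].
    exact: cvgM O1 cA.
  apply: cvg_trans; apply: near_eq_cvg.
  near=> x; have Ax : D.[x] + B.[x] != 0 by near: x; exact: near_A.
  have Ox : Omega a b x = B.[x] / (D.[x] + B.[x]) by near: x; exact: near_OmegaE.
  by rewrite Ox (hornerD D B) divfK.
move=> /(cvg_unique _ cB); rewrite mul1r (hornerD D B) => E.
by apply: (addIr B.[w]); rewrite add0r -E.
Unshelve. all: by end_near. Qed.

Lemma cvg_Omega_ninfty : Omega a b w @[w --> -oo] --> (1 : R).
Proof.
have cx := @cvg_chiQ_ninfty _ _ h d e nodes_inj d_gt0 ord0.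
have ce := @cvg_etaQ_ninfty _ _ h d e nodes_inj d_gt0 ord0.
apply/cvgrPdistC_lt => eps eps0; near=> w.
have : `|chiQ h d e w - e| < 1 by near: w; exact: (cvgrPdistC_lt _ _).1 cx _ ltr01.
have : `|etaQ h d w| < 1 by near: w; exact: (cvgr0Pnorm_lt _).1 ce _ ltr01.
(* With [chiQ] within 1 of [e] and [etaQ] within 1 of 0, this makes the denominator [q] less than
   [- 2 / eps], while the numerator of [Omega - 1] is below 2 in absolute value. *)
have : w < e - 3 - 2 / eps.
  by near: w; apply: nbhs_ninfty_lt; exact: num_real.
rewrite !ltr_norml => w1 /andP[e1 e2] /andP[c1 c2].
rewrite /Omega chiE etaE.
set q := w - _ + 1 - _.
have qe : q < - (2 / eps) by rewrite /q; lra.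
have p0 : 0 < 2 / eps by rewrite divr_gt0.
have q0 : q < 0 by lra.
have -> : (w - chiQ h d e w) / q - 1 = - (1 - etaQ h d w) / q.
  by rewrite /q; field; rewrite -/q lt_eqF.
rewrite -ltr_norml normrM normrN normrV ?unitfE ?lt_eqF// (ltr0_norm q0).
rewrite ltr_pdivrMr ?oppr_gt0// gtr0_norm; last lra.
have : 2 < eps * (- q) by rewrite [eps * _]mulrC -ltr_pdivrMr// ltrNr.
lra.
Unshelve. all: by end_near. Qed.

Lemma turning_pointE w : turning_point a b w <-> V.[w] = 0.
Proof.
rewrite -(@mup_critical _ _ h d e nodes_inj d_gt0 ord0) /turning_point /critical_poly.
rewrite chiE etaE.
suff -> : ('X - (chiQ h d e w)%:P) * A -
    ('X - (chiQ h d e w)%:P + 1 - (etaQ h d w)%:P) * Bab =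
  ('X - (chiQ h d e w)%:P) * D - (1 - etaQ h d w) *: B by [].
by rewrite AE BE -mul_polyC polyCB; ring.
Qed.

Let cof_w j w : D.[w] = (w - h j) * (cofP h j).[w].
Proof. exact: horner_nodeP_cof. Qed.

(* At a_0 the rational function B / D = w - e - sum_j d_j / (w - h_j) is -1. *)
Lemma e_gt : a ord0 + 1 < e.
Proof.
have D0 := horner_a_neq0 ord0; have := horner_num h d e (a ord0).
have ah j : a ord0 < h j.
  have /andP[bh _] := h_itv j; apply: lt_trans bh.
  exact: (interlaced_ab lt_ab lt_ba).
have -> : \sum_i d i * (cofP h i).[a ord0] =
    - (\sum_i d i / (h i - a ord0)) * D.[a ord0].
  rewrite mulNr mulr_suml -sumrN; apply: eq_bigr => j _.
  rewrite (cof_w j); field.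
  by rewrite subr_eq0 gt_eqF.
rewrite horner_a => E.
have : e - a ord0 - 1 = \sum_i d i / (h i - a ord0).
  by apply: (mulIf D0); lra.
have : 0 < \sum_i d i / (h i - a ord0).
  rewrite (bigD1 ord0)//= ltr_wpDr//.
    by apply: sumr_ge0 => j _; rewrite divr_ge0// ltW// subr_gt0.
  by rewrite divr_gt0// subr_gt0.
lra.
Qed.

(** At [b ord_max] the function [B / D] vanishes and all nodes lie to the left. Together with [e_gt]
    this puts the contact point [(e, 0)] on the bottom side. *)
Lemma e_lt : e < b ord_max.
Proof.
have D0 := horner_b_neq0 ord_max; have := horner_num h d e (b ord_max).
have ah j : h j < b ord_max.
  have /andP[_ bh] := h_itv j; apply: (lt_trans bh).
  by apply: (interlaced_ab lt_ab lt_ba); rewrite -ltnS.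
have -> : \sum_i d i * (cofP h i).[b ord_max] =
    (\sum_i d i / (b ord_max - h i)) * D.[b ord_max].
  rewrite mulr_suml; apply: eq_bigr => j _.
  rewrite (cof_w j); field.
  by rewrite subr_eq0 gt_eqF.
rewrite horner_b => E.
have : b ord_max - e = \sum_i d i / (b ord_max - h i).
  by apply: (mulIf D0); lra.
have : 0 < \sum_i d i / (b ord_max - h i).
  rewrite (bigD1 ord0)//= ltr_wpDr//.
    by apply: sumr_ge0 => j _; rewrite divr_ge0// ltW// subr_gt0.
  by rewrite divr_gt0// subr_gt0.
lra.
Qed.

Let derive1_chi w : derive1 (chi a b) w = dchiQ h d e w.
Proof.
by rewrite chiE derive1E; have /@derive_val := is_derive_chiQ e nodes_inj d_gt0 w.
Qed.

Let derive1_eta w : derive1 (eta a b) w = detaQ h d w.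
Proof.
by rewrite etaE derive1E; have /@derive_val := is_derive_etaQ nodes_inj d_gt0 w.
Qed.

Lemma tangent_slope w :
  [/\ derivable (chi a b) w 1,
      derivable (eta a b) w 1,
      Pi a b w = 1 -> derive1 (chi a b) w <> 0 /\ derive1 (eta a b) w = 0
    & Pi a b w <> 1 ->
      [/\ 1 - eta a b w <> 0,
          (w - chi a b w) / (1 - eta a b w) = slopeT a b w,
          ~ turning_point a b w ->
            derive1 (eta a b) w <> 0 /\
            derive1 (chi a b) w / derive1 (eta a b) w = slopeT a b w
        & derive1 (chi a b) x / derive1 (eta a b) x @[x --> w^']
            --> slopeT a b w]].
Proof.
split.
- by rewrite chiE; case: (is_derive_chiQ e nodes_inj d_gt0 w).
- by rewrite etaE; case: (is_derive_etaQ nodes_inj d_gt0 w).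
- move=> /Pi_eq1 D0; rewrite derive1_chi derive1_eta; split.
    apply/eqP; rewrite /dchiQ oppr_eq0 !mulf_eq0 invr_eq0 sqrf_eq0.
    rewrite (negbTE (Wn0 w)) pnatr_eq0/= orbF.
    rewrite (negbTE (cusp_root_neq0 nodes_inj d_gt0 D0))/=.
    by rewrite (negbTE (node_neq0 D0)).
  by rewrite /detaQ D0 mulr0 mul0r oppr0.
- move=> P1; have D0 : D.[w] != 0.
    by apply/eqP => /Pi_eq1.
  have Wn := Wn0 w.
  rewrite (slopeTE D0); split.
  + apply/eqP; rewrite etaE /etaQ opprB addrCA subrr addr0.
    by rewrite mulf_neq0 ?invr_eq0// sqrf_eq0.
  + rewrite chiE etaE.
    have -> : 1 - etaQ h d w = D.[w] ^+ 2 / W.[w] by rewrite /etaQ; ring.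
    have -> : w - chiQ h d e w = B.[w] * D.[w] / W.[w] by rewrite /chiQ; ring.
    by field; rewrite D0 Wn.
  + move=> /turning_pointE/eqP V0.
    have eta0 : detaQ h d w != 0.
      rewrite /detaQ oppr_eq0 mulf_neq0 ?invr_eq0 ?sqrf_eq0//.
      by rewrite mulf_neq0// mulf_neq0// pnatr_eq0.
    rewrite derive1_chi derive1_eta; split; first exact/eqP.
    by rewrite /dchiQ /detaQ; field; rewrite V0 D0 Wn.
  + have := cvg_slope (e := e) nodes_inj d_gt0 ord0 D0.
    by under eq_fun do rewrite -derive1_chi -derive1_eta.
Qed.

(** At [a i] one has [B = - D], so the direction [(B, D)] is that of [(-1, 1)] and
    [chi + eta = a i + 1]. *)
Lemma tangent_diagonal i :
  tangent_to_line (a i)^' (curve a b) (diagonal_side a b i).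
Proof.
have Ba := horner_a i; have Wn := Wn0 (a i).
exists (curve a b (a i)); rewrite curveE.
  rewrite /line_through/= /cross /curveQ/= /chiQ /etaQ Ba /diagonal_side.
  by case: ifP => _ /=; field.
apply: (tangent_directionQ nodes_inj d_gt0 ord0).
by rewrite Ba /diagonal_side; case: ifP => _ /=; ring.
Qed.

Lemma tangent_vertical i :
  tangent_to_line (b i)^' (curve a b) (vertical_side a b i).
Proof.
have Bb := horner_b i.
exists (curve a b (b i)); rewrite curveE.
  by rewrite /line_through/= /cross /curveQ/= /chiQ /etaQ Bb/=; ring.
apply: (tangent_directionQ nodes_inj d_gt0 ord0).
by rewrite Bb /vertical_side/= subrr mulr0 mul0r.
Qed.

Lemma tangent_top (j : 'I_m.+1) (i l : 'I_m.+2) :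
  b i < h j < a l ->
  tangent_to_segment (h j)^' (curve a b) (top_side a b i l).
Proof.
move=> /andP[bh ha].
exists (h j, 1); rewrite ?curveE.
  have ba : a l - b i != 0 by rewrite subr_eq0 gt_eqF// (lt_trans bh).
  exists ((h j - b i) / (a l - b i)).
    have ba0 : 0 < a l - b i by lra.
    apply/andP; split; last by rewrite ler_pdivrMr// mul1r; lra.
    by apply: divr_ge0; lra.
  by rewrite /top_side/=; congr (_, _); field.
have -> : (h j, 1) = curveQ h d e (h j).
  by rewrite /curveQ /chiQ /etaQ root_nodeP mulr0 expr0n/= !mul0r !subr0.
apply: (tangent_directionQ nodes_inj d_gt0 ord0).
by rewrite root_nodeP /top_side/= subrr mul0r mulr0.
Qed.

Lemma tangent_bottom (i j : 'I_m.+2) : i = 0%N :> nat -> j.+1 = m.+2 ->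
  tangent_to_segment -oo (curve a b) (bottom_side a b i j).
Proof.
move=> i0 jm; have -> : i = ord0 by exact: val_inj.
have -> : j = ord_max by apply: val_inj => /=; case: jm.
have e1 := e_gt.
have e2 := e_lt.
exists (e, 0); rewrite ?curveE.
  have ba : b ord_max - (a ord0 + 1) != 0 by rewrite subr_eq0 gt_eqF// (lt_trans e1).
  exists ((e - (a ord0 + 1)) / (b ord_max - (a ord0 + 1))).
    have ba0 : 0 < b ord_max - (a ord0 + 1) by lra.
    apply/andP; split; last by rewrite ler_pdivrMr// mul1r; lra.
    by apply: divr_ge0; lra.
  by rewrite /bottom_side/=; congr (_, _); field.
apply: (tangent_directionQ_ninfty e nodes_inj d_gt0 ord0).
by rewrite /bottom_side/= subrr.
Qed.


End FrozenBoundaryCurve.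

Theorem proposition2p7 (R : realType) (k : nat) (a b : 'I_k -> R)
    (k_ge2 : (2 <= k)%N)
    (lt_ab : forall i : 'I_k, a i < b i)
    (lt_ba : forall i j : 'I_k, j = i.+1 :> nat -> b i < a j)
    (sum_ab : \sum_(i < k) (b i - a i) = 1) :
  [/\ (* slope of the tangent vector; it is infinite where Pi w = 1, and at a
         turning point, where the tangent vector vanishes, it is a limit *)
      forall w : R,
      [/\ derivable (chi a b) w 1,
          derivable (eta a b) w 1,
          Pi a b w = 1 -> derive1 (chi a b) w <> 0 /\ derive1 (eta a b) w = 0
        & Pi a b w <> 1 ->
          [/\ 1 - eta a b w <> 0,
              (w - chi a b w) / (1 - eta a b w) = slopeT a b w,
              ~ turning_point a b w ->
                derive1 (eta a b) w <> 0 /\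
                derive1 (chi a b) w / derive1 (eta a b) w = slopeT a b w
            & derive1 (chi a b) x / derive1 (eta a b) x @[x --> w^']
                --> slopeT a b w]],
      (* (D) *)
      forall i : 'I_k,
      [/\ `|Omega a b w| @[w --> (a i)^'] --> +oo,
          boundary_segment (polygon_interior a b) (diagonal_side a b i)
        & tangent_to_line (a i)^' (curve a b) (diagonal_side a b i)],
      (* (V) *)
      forall i : 'I_k,
      [/\ Omega a b w @[w --> (b i)^'] --> (0 : R),
          boundary_segment (polygon_interior a b) (vertical_side a b i)
        & tangent_to_line (b i)^' (curve a b) (vertical_side a b i)]
    & (* (H), where [h j] is h_{j+1}: the value [h 0] is irrelevant, since
         h_1 = -oo, and w = -oo is treated separately *)
      exists h : 'I_k -> R,
      [/\ forall i j : 'I_k, j = i.+1 :> nat ->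
            [/\ b i < h j < a j,
                Omega a b w @[w --> (h j)^'] --> (1 : R),
                boundary_segment (polygon_interior a b) (top_side a b i j)
              & tangent_to_segment (h j)^' (curve a b) (top_side a b i j)],
          forall w : R, Omega a b x @[x --> w^'] --> (1 : R) ->
            exists2 j : 'I_k, (0 < j)%N & w = h j,
          Omega a b w @[w --> -oo] --> (1 : R),
          forall i j : 'I_k, i = 0%N :> nat -> j.+1 = k ->
            boundary_segment (polygon_interior a b) (bottom_side a b i j) /\
            tangent_to_segment -oo (curve a b) (bottom_side a b i j)
        & (* turning points *)
          forall i j : 'I_k, (0 < i)%N -> j = i.+1 :> nat ->
            exists! w : R, h i < w < h j /\ turning_point a b w]].
Proof.
case: k a b k_ge2 lt_ab lt_ba sum_ab => [|[|m]]// a b _ lt_ab lt_ba sum_ab.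
have [h [d [e [h_itv h_lt d_gt0 AB BE]]]] :=
  interlacing_partial_fractions lt_ab lt_ba sum_ab.
have h_inj := nodes_inj h_lt.
split.
- exact: (tangent_slope h_lt d_gt0 AB BE).
- move=> i; split.
  + exact: (cvg_Omega_a h_lt d_gt0 AB BE).
  + exact: boundary_diagonal.
  + exact: (tangent_diagonal h_lt d_gt0 AB BE).
- move=> i; split.
  + exact: (cvg_Omega_b h_lt d_gt0 AB BE).
  + exact: boundary_vertical.
  + exact: (tangent_vertical h_lt d_gt0 AB BE).
(* The [m.+1] nodes are shifted to the positive indices of ['I_m.+2]; index 0, which stands for
   [-oo], gets a dummy value. *)
pose hh (i : 'I_m.+2) := if unlift ord0 i is Some j then h j else 0.
have hhE j : hh (lift ord0 j) = h j by rewrite /hh liftK.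
have liftE (i : 'I_m.+2) : (0 < i)%N -> exists j, i = lift ord0 j.
  by case: (unliftP ord0 i) => [j ->|->]; [exists j|].
exists hh; split.
- move=> i l li; have [j lE] : exists j, l = lift ord0 j by apply: liftE; rewrite li.
  have iE : i = widen_ord (leqnSn m.+1) j.
    by apply: val_inj => /=; move: li; rewrite lE => -[].
  rewrite lE hhE iE; split.
  + exact: h_itv.
  + exact: (cvg_Omega_h h_lt d_gt0 AB BE).
  + exact: boundary_top.
  + exact: (tangent_top h_lt d_gt0 AB BE (h_itv j)).
- move=> w /(Omega_cvg1 h_lt d_gt0 AB BE)[j ->].
  by exists (lift ord0 j) => //; rewrite hhE.
- exact: (cvg_Omega_ninfty h_lt d_gt0 AB BE).
- move=> i j i0 jm; split; first exact: boundary_bottom.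
  exact: (tangent_bottom lt_ab lt_ba h_itv h_lt d_gt0 AB BE).
- move=> i j i0 ij; have [i' iE] := liftE i i0.
  have [j' jE] : exists j', j = lift ord0 j' by apply: liftE; rewrite ij.
  have ij' : j' = i'.+1 :> nat by move: ij; rewrite iE jE => -[].
  rewrite iE jE !hhE.
  have [|l|w [[wij Vw] uw]] := cuspP_unique h_inj d_gt0 (i := i') (j := j').
  + by apply: h_lt; rewrite ij'.
  + have [li|li] := leqP l i'.
      by left; move: li; rewrite leq_eqVlt => /orP[/eqP/val_inj ->//|/h_lt/ltW].
    right; move: li; rewrite -ij' leq_eqVlt => /orP[/eqP/val_inj ->//|/h_lt/ltW//].
  + exists w; split; first by split => //; apply/(turning_pointE h_lt d_gt0 AB BE).
    by move=> w' [wij' /(turning_pointE h_lt d_gt0 AB BE) Vw']; exact: uw.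
Qed.
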